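(* Let $G$ be a Cayley graph of a finitely generated group $\Gamma$, let $H$ be a subgroup of $\Gamma$ (not necessarily finitely generated), and let $p\in[0,1]$. If $H$ is amenable, then $G_p$ contains at most one $H$-infinite cluster almost surely. In particular, $p_c(H;G)=p_u(H;G)$.
   Context: Cayley graphs are taken with respect to finite generating sets. $G_p$ denotes Bernoulli bond percolation on $G$: each edge is independently retained (open) with probability $p$ and deleted otherwise; connected components of $G_p$ are called clusters. For a set $A$ of vertices, a cluster $K$ is called $A$-infinite if $|K\cap A|=\infty$. The relative critical probability and relative uniqueness threshold are $p_c(A;G)=\inf\{p\in[0,1]:\text{there exists an }A\text{-infinite cluster in }G_p\text{ a.s.}\}$ and $p_u(A;G)=\inf\{p\in[0,1]:\text{there exists a unique }A\text{-infinite cluster in }G_p\text{ a.s.}\}$. A countable group that is not finitely generated is amenable if and only if all of its finitely generated subgroups are. *)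

(* Defs.v *)
From Stdlib Require Export Relations.Relation_Operators.
From HB Require Export structures.
From mathcomp Require Export all_boot all_order all_algebra finmap.
From mathcomp Require Export all_classical all_reals all_analysis.

Set Implicit Arguments.
Unset Strict Implicit.
Unset Printing Implicit Defensive.
Import Order.TTheory GRing.Theory Num.Theory.
Local Open Scope classical_set_scope.
Local Open Scope ring_scope.

Section Groups.
Variable Gam : groupType.

Definition subgroup (H : set Gam) : Prop := group_closed [in H].

Definition generated (A : set Gam) : set Gam := smallest subgroup A.

(* Foelner's condition for the (possibly not finitely generated) discrete
   group H: both the finite set F of translations and the almost invariant
   set K are taken inside H.  If H is finitely generated, this says that its
   Cayley graphs have zero Cheeger constant; amenable_generated below treats
   the general case. *)
Definition amenable (H : set Gam) : Prop :=
  forall (F : {fset Gam}) (eps : rat), [set` F] `<=` H -> 0 < eps ->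
  exists K : {fset Gam}, [/\ K != fset0%fset, [set` K] `<=` H &
    forall s, s \in F ->
      (#|` ([fset (k * s)%g | k in K] `\` K)%fset|)%:R <= eps * (#|` K|)%:R].

Lemma generated_subgroup (A : set Gam) : subgroup (generated A).
Proof.
split; first by rewrite inE => B [[B1 _] _]; move: B1; rewrite inE.
move=> x y; rewrite !inE => hx hy B [sB AB].
have := sB.2 x y; rewrite !inE; apply; [exact: hx | exact: hy].
Qed.

(* A group is amenable iff all its finitely generated subgroups are. *)
Lemma amenable_generated (H : set Gam) : subgroup H ->
  amenable H <->
  forall T : {fset Gam}, [set` T] `<=` H -> amenable (generated [set` T]).
Proof.
move=> sH; split; last first.
  move=> h F eps FH e0.
  have [|K [K0 KL KF]] := h F FH F eps _ e0; first exact: sub_smallest.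
  exists K; split=> // x /KL; exact.
move=> aH T TH F eps FL e0.
set L := generated _ in FL *.
have sL : subgroup L := generated_subgroup _.
have LH : L `<=` H by move=> x; apply.
pose D (K : {fset Gam}) s := ([fset (k * s)%g | k in K] `\` K)%fset.
apply: contrapT => /forallNP noK.
have L1 : L 1%g by have := sL.1; rewrite inE.
have LV x y : L x -> L y -> L (x / y)%g by have := sL.2 x y; rewrite !inE.
have LI x : L x -> L x^-1%g by move=> hx; rewrite -[x^-1%g]mul1g; exact: LV.
have LM x y : L x -> L y -> L (x * y)%g.
  by move=> hx hy; rewrite -[y]invgK; apply: LV => //; exact: LI.
have bad (K : {fset Gam}) : K != fset0 -> [set` K] `<=` L ->
    eps * (#|` K|)%:R <= \sum_(s <- F) (#|` D K s|)%:R.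
  move=> K0 KL; have := noK K => /not_and3P.
  case=> // /existsNP[s] /not_implyP[sF] /negP; rewrite -ltNge => /ltW h.
  apply: (le_trans h); rewrite (big_fsetD1 s) //= lerDl.
  by apply: sumr_ge0.
have key n (K : {fset Gam}) : (#|` K| <= n)%N ->
    eps * (#|` K|)%:R <= \sum_(s <- F) (#|` D K s|)%:R.
  elim: n K => [|n IH] K.
    rewrite leqn0 => /eqP ->; rewrite mulr0; exact: sumr_ge0.
  have [->|[x xK]] := fset_0Vmem K.
    by rewrite cardfs0 mulr0 => _; exact: sumr_ge0.
  move=> Kn.
  pose C := [fset y in K | (x^-1 * y)%g \in L]%fset.
  pose K' := (K `\` C)%fset.
  have inC y : (y \in C) = (y \in K) && ((x^-1 * y)%g \in L) by rewrite !inE.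
  have CK : (C `<=` K)%fset by apply/fsubsetP => y; rewrite !inE => /andP[].
  have xC : x \in C by rewrite inC xK mulVg; apply/mem_set.
  have cK : #|` K| = (#|` C| + #|` K'|)%N.
    by rewrite -(cardfsID C) (fsetIidPr CK).
  have K'n : (#|` K'| <= n)%N.
    have : (0 < #|` C|)%N by rewrite cardfs_gt0; apply/fset0Pn; exists x.
    by move: Kn; rewrite cK; case: #|` C| => // m; rewrite addSn ltnS => h _; apply: leq_trans h; exact: leq_addl.
  have shift k s : s \in F -> ((x^-1 * (k * s))%g \in L) = ((x^-1 * k)%g \in L).
    move=> sF; have sLs : L s by exact: FL.
    apply/idP/idP; rewrite !inE mulgA => h; last exact: LM.
    by have := LV _ _ h sLs; rewrite mulgK.
  have DK s : s \in F -> (#|` D K s| = #|` D C s| + #|` D K' s|)%N.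
    move=> sF; have -> : D K s = (D C s `|` D K' s)%fset.
      apply/fsetP => y; rewrite in_fsetU !in_fsetD.
      apply/andP/orP.
        move=> [yK /imfsetP[k /= kK ykE]].
        have [kL|kL] := boolP ((x^-1 * k)%g \in L).
          left; apply/andP; split; first by apply: contra yK; move/(fsubsetP CK).
          by apply/imfsetP; exists k => //=; rewrite !inE kK.
        right; apply/andP; split.
          by rewrite (negbTE yK) andbF.
        by apply/imfsetP; exists k => //=; rewrite in_fsetD kK inC kK (negbTE kL).
      case=> /andP[yn /imfsetP[k /= kC ykE]].
        move: kC; rewrite inC => /andP[kK kL]; split; last by apply/imfsetP; exists k.
        by move: yn; rewrite inC ykE shift // kL andbT.
      move: kC; rewrite in_fsetD inC => /andP[kC kK].
      split; last by apply/imfsetP; exists k.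
      by move: kC yn; rewrite inC kK /= ykE shift // => /negbTE ->; rewrite andbF.
    apply/eqP; rewrite -(eqn_add2r #|` (D C s `&` D K' s)%fset|) cardfsUI.
    suff -> : (D C s `&` D K' s)%fset = fset0 by rewrite cardfs0 addn0.
    apply/fsetP => y; rewrite in_fset0; apply/negbTE/negP.
    rewrite in_fsetI !in_fsetD => /andP[/andP[_ /imfsetP[k /= kC ->]]].
    case/andP=> _ /imfsetP[k' /= k'K /mulIg kk'].
    by move: k'K; rewrite -kk' in_fsetD kC.
  rewrite cK natrD mulrDr.
  have -> : \sum_(s <- F) (#|` D K s|)%:R =
     \sum_(s <- F) (#|` D C s|)%:R + \sum_(s <- F) (#|` D K' s|)%:R :> rat.
    rewrite -big_split /= big_seq [RHS]big_seq; apply: eq_bigr => s sF.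
    by rewrite DK // natrD.
  apply: lerD; last exact: IH.
  pose C1 := [fset (x^-1 * k)%g | k in C]%fset.
  have inj : injective (fun k : Gam => (x^-1 * k)%g) by exact: mulgI.
  have cC1 : #|` C1| = #|` C| by rewrite card_imfset.
  have DC1 s : #|` D C1 s| = #|` D C s|.
    have <- : #|` [fset (x^-1 * k)%g | k in D C s]%fset| = #|` D C s|.
      by rewrite card_imfset.
    congr (#|` _|); apply/fsetP => y; rewrite in_fsetD; apply/andP/imfsetP => /=.
      move=> [yC /imfsetP[z /= /imfsetP[k /= kC ->] yE]].
      exists (k * s)%g; last by rewrite yE mulgA.
      rewrite in_fsetD; apply/andP; split; last by apply/imfsetP; exists k.
      apply: contra yC => h; rewrite yE -mulgA; apply/imfsetP; by exists (k * s)%g.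
    move=> [z]; rewrite in_fsetD => /andP[zC /imfsetP[k /= kC zE]] ->; split.
      by apply: contra zC => /imfsetP[k' /= k'C /mulgI ->].
    apply/imfsetP; exists (x^-1 * k)%g; last by rewrite zE mulgA.
    by apply/imfsetP; exists k.
  rewrite -cC1; under eq_bigr do rewrite -DC1.
  apply: bad.
    by apply/fset0Pn; exists (x^-1 * x)%g; apply/imfsetP; exists x.
  by move=> y /= /imfsetP[k /=]; rewrite inC => /andP[_ /set_mem ? ->].
pose m : rat := (#|` F|.+1)%:R.
have m0 : 0 < m by rewrite ltr0n.
have [|K [K0 KH KF]] := aH F (eps / m) (subset_trans FL LH).
  by rewrite divr_gt0.
have K0' : 0 < (#|` K|)%:R :> rat by rewrite ltr0n cardfs_gt0.
have := key _ K (leqnn _); apply/negP; rewrite -ltNge.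
apply: (@le_lt_trans _ _ (\sum_(s <- F) (eps / m * (#|` K|)%:R))).
  by rewrite big_seq [leRHS]big_seq; apply: ler_sum => s sF; exact: KF.
rewrite big_const_seq count_predT iter_addr_0 -[_ *+ size _]mulr_natr.
have mF : (#|` F|)%:R < m by rewrite ltr_nat.
rewrite (_ : eps / m * _ * _ = eps * (#|` K|)%:R * ((#|` F|)%:R / m)).
  by rewrite gtr_pMr ?mulr_gt0 // ltr_pdivrMr // mul1r.
by rewrite -[LHS]mulrA mulrACA; congr (_ * _); rewrite mulrC.
Qed.
End Groups.

Section Cayley.
Variables (Gam : groupType) (S : {fset Gam}).

(* Right Cayley graph, as a simple undirected graph: loops are dropped, and
   s and s^-1 give the same edge. *)
Definition cayley_adj (x y : Gam) : Prop :=
  x <> y /\ ((x^-1 * y)%g \in S \/ (y^-1 * x)%g \in S).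

Definition cayley_edges : set (set Gam) :=
  [set e | exists x y, cayley_adj x y /\ e = [set x; y]].

Definition edge_open (e : cayley_edges) : set (cayley_edges -> bool) :=
  [set w | w e].

(* {0,1}^E with the product sigma-algebra; w e = true means that e is open. *)
Definition config := g_sigma_algebraType (range edge_open).

Definition open_adj (w : config) (x y : Gam) : Prop :=
  exists e : cayley_edges, set_val e = [set x; y] /\ w e.

Definition cluster_of (w : config) (x : Gam) : set Gam :=
  [set y | clos_refl_trans Gam (open_adj w) x y].

Definition clusters (w : config) : set (set Gam) := range (cluster_of w).

Definition infinite_cluster (A : set Gam) (w : config) (K : set Gam) : Prop :=
  clusters w K /\ infinite_set (K `&` A).

End Cayley.

Section Percolation.
Variables (R : realType) (Gam : groupType) (S : {fset Gam}).

(* P is the law of G_p, i.e. the product of the Bernoulli(p) laws. Its values on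
   cylinders determine P. *)
Definition bernoulli_percolation (p : R) (P : probability (config S) R) : Prop :=
  forall (F : {fset cayley_edges S}) (b : cayley_edges S -> bool),
    P [set w : config S | forall e, e \in F -> w e = b e] =
    (\prod_(e <- F) (if b e then p else 1 - p))%:E.

Variable Perc : R -> probability (config S) R.

(* As infima in the extended reals, so that inf set0 = +oo. *)
Definition p_c (A : set Gam) : \bar R :=
  ereal_inf [set p%:E | p in [set p : R | 0 <= p <= 1 /\
    {ae Perc p, forall w, exists K, infinite_cluster A w K}]].

Definition p_u (A : set Gam) : \bar R :=
  ereal_inf [set p%:E | p in [set p : R | 0 <= p <= 1 /\
    {ae Perc p, forall w, exists! K, infinite_cluster A w K}]].

End Percolation.

(* Main.v *)
From mathcomp Require Import ring lra zify.
Require Import Defs.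

(** The argument is that of Burton and Keane, run along the orbit of a point
    under [H] instead of along all vertices.  Left translations by [H] preserve
    both the law of the configuration and the set [H], while the Foelner sets of
    [H] are almost invariant under right translations by finite subsets of [H].

    Suppose that two [H]-infinite clusters coexist with positive probability.
    This event is invariant under [H], and [H] is infinite, so a finite connected
    pattern of edges has arbitrarily many edge-disjoint translates by [H].  By
    the second moment method the event is no less likely when the pattern is
    open (invariant_open_ge).  Opening a pattern can merge [H]-infinite clusters
    but cannot create any, so almost surely non-uniqueness survives the opening
    of every pattern; choosing one that joins two [H]-infinite clusters shows
    that there is a third one (nonunique_has_third).  Here [p > 0] is used; for
    [p = 0] almost surely no edge is open.  Closing and then opening a
    pattern [B] that meets all three yields, with some probability [c > 0], a
    trifurcation: [B] is open, and closing it leaves three vertices of [B] in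
    distinct [H]-infinite clusters (nonnegligible_trifurcation).

    The counting differs from the classical one.  An open path between two points
    of [H] may leave every bounded neighbourhood of [H], so the number of branches
    that leave a Foelner set [K] is not bounded by the size of a boundary of [K].
    Instead, fix [m] and ask that each of the three branches of the trifurcation
    at [x] contain [m] points of [x * F], where [F] is a finite subset of [H];
    for [F] large this still has probability at least [c / 2].  For at least half
    of the points [x] of a suitable Foelner set [K] one has [x * F] inside [K].
    The trifurcations at such points cut each cluster in a tree-like way.  Fix a
    root in each cluster; two of the three branches at each trifurcation avoid the
    root, and the traces of all these branches on [K] form a laminar family of
    sets with at least [m] points, whence [m * #|T| <= #|K|] for a set [T] of edge-disjoint
    trifurcations (laminar_card, branch_points_card).  Taking expectations gives
    [m * c / 2 <= 2 * d], where [d] depends on [B] only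
    (prob_trifurcation_le).  This is absurd once [m] is large. *)

Set Implicit Arguments.
Unset Strict Implicit.
Unset Printing Implicit Defensive.
Import Order.TTheory GRing.Theory Num.Theory.
Import numFieldNormedType.Exports.
Local Open Scope classical_set_scope.
Local Open Scope ring_scope.

(** * Open paths and finite connected patterns of edges *)

Section Connectivity.
Variables (Gam : groupType) (S : {fset Gam}).
Local Notation E := (cayley_edges S).
Implicit Types (w : config S) (x y z : Gam) (B : {fset E}) (V : {fset Gam}).

Definition conn w x y : Prop := clos_refl_trans Gam (open_adj w) x y.

Definition set_edges (b : bool) B w : config S :=
  fun e => if e \in B then b else w e.

Definition edges_open B w : Prop := forall e, e \in B -> w e.

Lemma conn_refl w x : conn w x x.
Proof. exact: rt_refl. Qed.

Lemma conn_trans w y x z : conn w x y -> conn w y z -> conn w x z.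
Proof. by move=> ? ?; apply: rt_trans; eassumption. Qed.

Lemma open_adj_sym w x y : open_adj w x y -> open_adj w y x.
Proof. by move=> [e [ex we]]; exists e; rewrite ex setUC. Qed.

Lemma conn_sym w x y : conn w x y -> conn w y x.
Proof.
elim=> [a b ab|a|a b c _ ba _ cb]; last exact: conn_trans cb ba.
  by apply: rt_step; exact: open_adj_sym.
exact: conn_refl.
Qed.

(** Induction along an open path in invariant form: the form in which
    properties of reachable vertices are proved below. *)
Lemma conn_preserves w (Q : Gam -> Prop) :
  (forall y z, Q y -> open_adj w y z -> Q z) ->
  forall x y, conn w x y -> Q x -> Q y.
Proof.
move=> step x y; elim=> [a b ab Qa|//|a b c _ ab _ bc Qa].
  exact: step ab.
by apply: bc; exact: ab.
Qed.

Lemma conn_step w x y z : conn w x y -> open_adj w y z -> conn w x z.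
Proof. by move=> xy yz; apply: (conn_trans xy); exact: rt_step. Qed.

Lemma sub_conn w w' x y : (forall e, w e -> w' e) -> conn w x y -> conn w' x y.
Proof.
move=> ww' xy; apply: (conn_preserves _ xy); last exact: conn_refl.
move=> a b xa [e [eab we]]; apply: conn_step xa _.
by exists e; split => //; exact: ww'.
Qed.

Lemma edge_mem (e : E) x y : set_val e = [set x; y] -> set_val e x /\ set_val e y.
Proof. by move=> ->; split; [left|right]. Qed.

(** Once its edges are open, a pattern is connected, so that opening it merges all
    clusters that it meets; all other edges touch those of [B] only at the
    finitely many vertices of [V].  The second clause quantifies over [w] so that
    it can be used in any configuration in which the edges of [B] are open. *)
Definition pattern B V : Prop :=
  (forall e x, e \in B -> set_val e x -> x \in V) /\
  (forall w x y, edges_open B w -> x \in V -> y \in V -> conn w x y).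

Lemma pattern_union B1 V1 B2 V2 x : pattern B1 V1 -> pattern B2 V2 ->
  x \in V1 -> x \in V2 -> pattern (B1 `|` B2)%fset (V1 `|` V2)%fset.
Proof.
move=> [e1 c1] [e2 c2] x1 x2; split=> [e y|w y z wo].
  by rewrite !inE => /orP[/e1 h|/e2 h] /h ->//; rewrite orbT.
have o1 : edges_open B1 w by move=> e eB; apply: wo; rewrite !inE eB.
have o2 : edges_open B2 w by move=> e eB; apply: wo; rewrite !inE eB orbT.
have cx u : u \in (V1 `|` V2)%fset -> conn w u x.
  by rewrite !inE => /orP[u1|u2]; [exact: c1|exact: c2].
by move=> /cx yx /cx zx; apply: conn_trans yx _; exact: conn_sym.
Qed.

(** Consecutive pieces of an open path share an endpoint, so their patterns can be
    united. *)
Lemma path_pattern w x y : conn w x y ->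
  exists B V, [/\ pattern B V, x \in V & y \in V].
Proof.
elim=> [a b [e [eab we]]|a|a b c _ [B1 [V1 [p1 a1 b1]]] _ [B2 [V2 [p2 b2 c2]]]].
- exists [fset e]%fset, [fset a; b]%fset; split; rewrite ?inE ?eqxx ?orbT //.
  split=> [e' u|w' u v wo].
    by move=> /fset1P ->; rewrite eab => -[]->; rewrite !inE eqxx ?orbT.
  have ab : conn w' a b.
    by apply: rt_step; exists e; split=> //; apply: wo; apply/fset1P.
  have ba := conn_sym ab.
  by rewrite !inE => /orP[]/eqP-> /orP[]/eqP->//; exact: conn_refl.
- exists fset0, [fset a]%fset; split; rewrite ?inE ?eqxx //.
  split=> // w' u v _; rewrite !inE => /eqP-> /eqP->; exact: conn_refl.
- exists (B1 `|` B2)%fset, (V1 `|` V2)%fset; split.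
  + exact: pattern_union p1 p2 b1 b2.
  + by rewrite inE a1.
  + by rewrite inE c2 orbT.
Qed.

(** The elements [y] such that right multiplication by [y] and by [y^-1] preserves
    [Q] form a subgroup, which contains the generators. *)
Lemma generated_ind (Q : set Gam) : generated [set` S] = [set: Gam] ->
  Q 1%g -> (forall x s, Q x -> s \in S -> Q (x * s)%g /\ Q (x * s^-1)%g) ->
  forall x, Q x.
Proof.
move=> genS Q1 Qs x.
pose L := [set y | forall x, Q x -> Q (x * y)%g /\ Q (x * y^-1)%g].
have : generated [set` S] x by rewrite genS.
move=> /(_ L) Lx; suff /Lx : subgroup L /\ [set` S] `<=` L.
  by move=> /(_ 1%g Q1)[]; rewrite mul1g.
split=> [|s /= sS y Qy]; last exact: Qs.
split; first by rewrite inE => y Qy; rewrite invg1 mulg1.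
move=> a b; rewrite !inE => La Lb y Qy.
have [ya _] := La y Qy; have [yb _] := Lb y Qy.
by rewrite invgF !mulgA; split; [have [] := Lb _ ya|have [] := La _ yb].
Qed.

Lemma cayley_connected : generated [set` S] = [set: Gam] ->
  forall x, conn (fun=> true) 1%g x.
Proof.
move=> genS; apply: generated_ind => //; first exact: conn_refl.
have adj x y : cayley_adj S x y -> open_adj (S := S) (fun=> true) x y.
  move=> xy; have xyE : [set x; y] \in cayley_edges S.
    by apply/mem_set; exists x, y.
  by exists (SigSub xyE); split.
move=> x s xc sS; split.
- have [->//|nx] := pselect ((x * s)%g = x).
  apply: conn_step xc _; apply: adj; split; first by move/esym.
  by left; rewrite mulKg.
- have [->//|nx] := pselect ((x * s^-1)%g = x).
  apply: conn_step xc _; apply: adj; split; first by move/esym.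
  by right; rewrite invgF mulgVK.
Qed.

Lemma pattern_exists : generated [set` S] = [set: Gam] ->
  forall s : seq Gam, exists B V, pattern B V /\ forall x, x \in s -> x \in V.
Proof.
move=> genS s.
suff [B [V [pB _ h]]] : exists B V, [/\ pattern B V, 1%g \in V
    & forall x, x \in s -> x \in V] by exists B, V.
elim: s => [|x s [B [V [pB V1 sV]]]].
  have [B [V [pB V1 _]]] := path_pattern (conn_refl (fun=> true) 1%g).
  by exists B, V.
have [B' [V' [pB' V1' xV']]] := path_pattern (cayley_connected genS x).
exists (B `|` B')%fset, (V `|` V')%fset; split.
- exact: pattern_union pB pB' V1 V1'.
- by rewrite inE V1.
- by move=> y; rewrite !inE => /orP[/eqP->|/sV->//]; rewrite xV' orbT.
Qed.

(** The words in the generators and their inverses are countable.  A surjection is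
    enough to turn quantifiers over the group into countable operations. *)
Lemma group_enum : generated [set` S] = [set: Gam] ->
  exists g : nat -> Gam, forall x, exists n, g n = x.
Proof.
move=> genS.
pose val (l : seq (bool * S)) := foldr (fun bs x =>
  (x * (if bs.1 then fsval bs.2 else (fsval bs.2)^-1))%g) 1%g l.
pose dec n : seq (bool * S) := oapp id [::] (choice.unpickle n).
have decK l : dec (choice.pickle l) = l by rewrite /dec choice.pickleK.
exists (fun n => val (dec n)).
apply: generated_ind => //; first by exists (choice.pickle ([::] : seq (bool * S))); rewrite decK.
move=> x s [n nx] sS; split.
  by exists (choice.pickle ((true, [` sS]%fset) :: dec n)); rewrite decK /= nx.
by exists (choice.pickle ((false, [` sS]%fset) :: dec n)); rewrite decK /= nx.
Qed.

Lemma enum_bound (g : nat -> Gam) (s : seq Gam) : (forall x, exists n, g n = x) ->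
  exists n, forall x, x \in s -> exists2 k, (k < n)%N & g k = x.
Proof.
move=> gP; elim: s => [|y s [n IH]]; first by exists 0%N.
have [k gk] := gP y; exists (maxn n k.+1) => z.
rewrite in_cons => /orP[/eqP->|/IH[j jn gj]].
  by exists k => //; rewrite leq_max ltnS leqnn orbT.
by exists j => //; rewrite leq_max jn.
Qed.

End Connectivity.

(** * Laminar families and separated sets *)

(** Think of [i] as a branching point of a forest, with two branches [A i] and
    [B i] away from the root.  At a branching point [i] whose branches are as
    small as possible, no other branching point lies below; delete the branch
    [B i] from the ground set and forget [i].  Any other branch that contained both
    branches of [i] still contains [A i], hence still has [m] points.  Each
    such step removes [m] points from [K], so there are at most [#|K| / m]
    steps. *)
Lemma laminar_card (I T : choiceType) (m : nat) (J : {fset I})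
    (A B : I -> {fset T}) (K : {fset T}) : (0 < m)%N ->
  (forall i, i \in J -> [/\ (A i `<=` K)%fset, (B i `<=` K)%fset,
     [disjoint A i & B i]%fset, (m <= #|` A i|)%N & (m <= #|` B i|)%N]) ->
  (forall i j, i \in J -> j \in J -> i <> j ->
     let U k := (A k `|` B k)%fset in
     [\/ (U i `<=` A j)%fset \/ (U i `<=` B j)%fset,
         (U j `<=` A i)%fset \/ (U j `<=` B i)%fset
       | [disjoint U i & U j]%fset]) ->
  (m * #|` J| <= #|` K|)%N.
Proof.
move=> m0.
have [n] := ubnP #|` J|; elim: n J A B K => // n IH J A B K Jn AB lam.
have [->|[i0 i0J]] := fset_0Vmem J; first by rewrite cardfs0 muln0.
pose U k := (A k `|` B k)%fset.
pose i := [arg min_(i < [` i0J]%fset) #|` U (val i)|]%N.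
have [iJ imin] : val i \in J /\ forall j, j \in J -> (#|` U (val i)| <= #|` U j|)%N.
  split; first exact: valP.
  rewrite /i; case: arg_minnP => // k _ kmin j jJ.
  exact: (kmin [` jJ]%fset).
move: (val i) iJ imin => {}i iJ imin.
have [AiK BiK ABi Aim Bim] := AB i iJ.
have Ucard : #|` U i| = (#|` A i| + #|` B i|)%N.
  by rewrite cardfsU (disjoint_fsetI0 ABi) cardfs0 subn0.
(* By minimality [U j] has at least as many points as [U i], that is, more than
   either branch of [i]. *)
have notin j : j \in J -> ~ ((U j `<=` A i)%fset \/ (U j `<=` B i)%fset).
  move=> /imin; rewrite Ucard => h [] /fsubset_leq_card h'.
    have := leq_trans h h'; rewrite -[leqRHS]addn0 leq_add2l leqn0 => /eqP B0.
    by move: Bim; rewrite B0 leqNgt m0.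
  have := leq_trans h h'; rewrite -[leqRHS]add0n leq_add2r leqn0 => /eqP A0.
  by move: Aim; rewrite A0 leqNgt m0.
have JD : #|` J| = #|` J `\ i|%fset.+1 by rewrite [LHS](cardfsD1 i) iJ.
have KD : #|` K| = (#|` B i| + #|` K `\` B i|)%N%fset.
  by rewrite -(cardfsID (B i) K) (fsetIidPr BiK).
rewrite JD mulnS KD; apply: leq_add => //.
apply: (IH (J `\ i)%fset (fun j => A j `\` B i)%fset (fun j => B j `\` B i)%fset).
- by move: Jn; rewrite JD ltnS.
- move=> j; rewrite in_fsetD1 => /andP[/eqP ji jJ].
  have [AjK BjK ABj Ajm Bjm] := AB j jJ.
  have big (C : {fset T}) : (m <= #|` C|)%N ->
      (U i `<=` C)%fset \/ [disjoint U i & C]%fset -> (m <= #|` C `\` B i|)%N%fset.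
    move=> Cm [UC|UC].
      apply: (leq_trans Aim); apply/fsubset_leq_card/fsubsetP => x xA.
      rewrite in_fsetD (fsubsetP UC) ?in_fsetU ?xA // andbT.
      by move/fdisjointP: ABi; apply.
    apply: (leq_trans Cm); apply/fsubset_leq_card/fsubsetP => x xC.
    rewrite in_fsetD xC andbT; apply/negP => xB.
    by move/fdisjointP: UC => /(_ x); rewrite in_fsetU xB orbT xC => /(_ isT).
  have dis C D : [disjoint C & D]%fset -> (U i `<=` C)%fset ->
      [disjoint U i & D]%fset.
    by move=> CD UC; exact: fdisjointWl UC CD.
  have UU : [disjoint U i & U j]%fset ->
    [disjoint U i & A j]%fset /\ [disjoint U i & B j]%fset.
    by rewrite fdisjointXU => /andP[].
  split.
  + exact: fsetSD.
  + exact: fsetSD.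
  + apply/fdisjointP => x; rewrite !in_fsetD => /andP[_ xA].
    by move/fdisjointP: ABj => /(_ x xA) /negbTE ->; rewrite andbF.
  + apply: big => //; case: (lam i j iJ jJ (nesym ji)) => [[]h|/(notin _ jJ)//|/UU[h _]].
    * by left.
    * by right; apply: dis h; rewrite fdisjoint_sym.
    * by right.
  + apply: big => //; case: (lam i j iJ jJ (nesym ji)) => [[]h|/(notin _ jJ)//|/UU[_ h]].
    * by right; apply: dis h.
    * by left.
    * by right.
- move=> j k; rewrite !in_fsetD1 => /andP[_ jJ] /andP[_ kJ] jk /=.
  rewrite -!fsetDUl; case: (lam j k jJ kJ jk) => [[]h|[]h|h].
  + by apply: Or31; left; exact: fsetSD.
  + by apply: Or31; right; exact: fsetSD.
  + by apply: Or32; left; exact: fsetSD.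
  + by apply: Or32; right; exact: fsetSD.
  + apply: Or33; apply/fdisjointP => x; rewrite !in_fsetD => /andP[_ xA].
    by move/fdisjointP: h => /(_ x xA) /negbTE ->; rewrite andbF.
Qed.

(** Greedy choice: keep a point [x] and discard its neighbours, which all lie in
    the translate [x * W]. *)
Lemma separated_subset (Gam : groupType) (W T : {fset Gam}) :
  1%g \in W -> (forall x, x \in W -> x^-1%g \in W) ->
  exists I : {fset Gam}, [/\ (I `<=` T)%fset,
    forall x y, x \in I -> y \in I -> x <> y -> (x^-1 * y)%g \notin W
    & (#|` T| <= #|` W| * #|` I|)%N].
Proof.
move=> W1 WV; have [n] := ubnP #|` T|; elim: n T => // n IH T Tn.
have [->|[x xT]] := fset_0Vmem T.
  by exists fset0; split; rewrite ?cardfs0 // fsub0set.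
pose T' := [fset y in T | (x^-1 * y)%g \notin W]%fset.
have inT' y : (y \in T') = (y \in T) && ((x^-1 * y)%g \notin W) by rewrite !inE.
have xT' : x \notin T' by rewrite inT' mulVg W1 andbF.
have T'T : (T' `<=` T)%fset by apply/fsubsetP => y; rewrite inT' => /andP[].
have [|I [IT' Isep IT]] := IH T'.
  rewrite -ltnS; apply: leq_trans Tn; rewrite ltnS; apply: fproper_ltn_card.
  by rewrite fproperE T'T; apply/fsubsetPn; exists x.
exists (x |` I)%fset; split.
- by rewrite fsubUset fsub1set xT (fsubset_trans IT' T'T).
- have sep y : y \in I -> (x^-1 * y)%g \notin W.
    by move=> /(fsubsetP IT'); rewrite inT' => /andP[].
  move=> y z /fset1UP[->|yI] /fset1UP[->|zI] // yz; [exact: sep| |exact: Isep].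
  by apply: contra (sep y yI) => /WV; rewrite invgM invgK.
- have xI : x \notin I by apply: contra xT' => /(fsubsetP IT').
  rewrite cardfsU1 xI mulnDr muln1.
  have -> : #|` T| = (#|` T `\` T'| + #|` T'|)%N%fset.
    by rewrite -(cardfsID T' T) (fsetIidPr T'T) addnC.
  apply: leq_add => //.
  have <- : #|` [fset (x * u)%g | u in W]%fset| = #|` W|.
    by rewrite card_imfset //; exact: mulgI.
  apply/fsubset_leq_card/fsubsetP => y; rewrite in_fsetD inT' => /andP[+ yT].
  rewrite yT /= negbK => yW; apply/imfsetP; exists (x^-1 * y)%g => //=.
  by rewrite mulVKg.
Qed.

(** * Surgery on finitely many edges, and translations *)

Section Surgery.
Variables (Gam : groupType) (S : {fset Gam}).
Local Notation E := (cayley_edges S).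
Implicit Types (w : config S) (x y z h : Gam) (B : {fset E}) (V : {fset Gam}).

Definition infinite_at (H : set Gam) w x : Prop :=
  infinite_set (cluster_of w x `&` H).

Lemma cluster_eq w x y : conn w x y -> cluster_of w x = cluster_of w y.
Proof.
move=> xy; apply/seteqP; split => z; [exact/conn_trans/conn_sym|exact: conn_trans].
Qed.

Lemma set_edges_open_sub B w e : w e -> set_edges true B w e.
Proof. by rewrite /set_edges; case: ifP. Qed.

Lemma set_edges_closed_sub B w e : set_edges false B w e -> w e.
Proof. by rewrite /set_edges; case: ifP. Qed.

Lemma set_edges_off b B w e : set_edges b B w e -> e \in B \/ w e.
Proof. by rewrite /set_edges; case: ifP; [left|right]. Qed.

Lemma off_set_edges B w e : w e -> e \in B \/ set_edges false B w e.
Proof. by rewrite /set_edges; case: ifP; [left|right]. Qed.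

Section Detour.
Variables (B : {fset E}) (V : {fset Gam}) (w w' : config S).
Hypothesis endB : forall e x, e \in B -> set_val e x -> x \in V.
Hypothesis offB : forall e, w' e -> e \in B \/ w e.

(** A path that is open in [w'] is cut at the last edge of [B] that it uses; the
    rest of it is open in [w]. *)
Lemma last_exit x y : conn w' x y ->
  conn w x y \/ exists v, [/\ v \in V, conn w' x v & conn w v y].
Proof.
move=> xy; pose Q z := conn w' x z /\ (conn w x z \/
   exists v, [/\ v \in V, conn w' x v & conn w v z]).
suff [] : Q y by [].
apply: (conn_preserves (Q := Q) _ xy); last by split; [exact: conn_refl|left; exact: conn_refl].
move=> a b [xa ih] ab; split; first exact: conn_step ab.
have [e [eab we]] := ab; have [_ eb] := edge_mem eab.
case: (offB we) => [eB|we'].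
  right; exists b; split; [exact: endB eb|exact: conn_step ab|exact: conn_refl].
have wab : open_adj w a b by exists e.
case: ih => [xaw|[v [vV xv va]]]; first by left; exact: conn_step wab.
by right; exists v; split => //; exact: conn_step wab.
Qed.

Lemma conn_avoiding x y : (forall v, v \in V -> ~ conn w' x v) ->
  conn w' x y -> conn w x y.
Proof. by move=> noV /last_exit[//|[v [/noV]]]. Qed.

(** By last_exit the cluster of [x] in [w'] is covered by finitely many clusters
    of [w], so that one of these is [H]-infinite. *)
Lemma infinite_branch (H : set Gam) x : infinite_at H w' x ->
  exists v, [/\ v = x \/ v \in V, conn w' x v & infinite_at H w v].
Proof.
move=> infx; apply: contrapT => no; apply: infx.
pose F v := [set z | conn w' x v /\ (cluster_of w v `&` H) z].
have finF v : v \in (x |` V)%fset -> finite_set (F v).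
  move=> vV; have [xv|nxv] := pselect (conn w' x v).
    have : finite_set (cluster_of w v `&` H).
      apply: contrapT => infv; apply: no; exists v; split => //.
      by move: vV => /fset1UP[->|]; [left|right].
    by apply: sub_finite_set => z [].
  by apply: sub_finite_set (finite_set0 _) => z [].
apply: (@sub_finite_set _ _ (\bigcup_(v in [set` (x |` V)%fset]) F v)).
  move=> z [xz Hz]; case: (last_exit xz) => [wxz|[v [vV xv vz]]].
    by exists x; [exact: fset1U1|split; [exact: conn_refl|]].
  by exists v; [exact: fset1Ur|].
by apply: bigcup_finite => // v; exact: finF.
Qed.

End Detour.

Lemma cayley_edge_translate h (e : set Gam) : cayley_edges S e ->
  cayley_edges S [set (h * z)%g | z in e].
Proof.
move=> [x [y [[xy sxy] ->]]]; exists (h * x)%g, (h * y)%g.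
split; last by rewrite image_setU !image_set1.
split; first by move/mulgI.
by rewrite !invgM -!mulgA !mulKg.
Qed.

Definition translate_edge h (e : E) : E :=
  SigSub (mem_set (cayley_edge_translate h (set_mem (valP e)))).

Lemma translate_edgeE h e : set_val (translate_edge h e) = [set (h * z)%g | z in set_val e].
Proof. by []. Qed.

Lemma edge_inj (e f : E) : set_val e = set_val f -> e = f.
Proof. exact: val_inj. Qed.

Lemma translate_edgeM h k e :
  translate_edge h (translate_edge k e) = translate_edge (h * k)%g e.
Proof.
apply: edge_inj; rewrite !translate_edgeE image_comp.
by congr (_ @` _); apply/funext => z /=; rewrite mulgA.
Qed.

Lemma translate_edge1 e : translate_edge 1%g e = e.
Proof.
apply: edge_inj; rewrite translate_edgeE -[RHS]image_id.
by congr (_ @` _); apply/funext => z /=; rewrite mul1g.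
Qed.

Lemma translate_edge_inj h : injective (translate_edge h).
Proof.
by apply: (can_inj (g := translate_edge h^-1)) => e; rewrite translate_edgeM mulVg translate_edge1.
Qed.

Definition translate h w : config S := fun e => w (translate_edge h e).

Lemma open_adj_translate h w x y :
  open_adj (translate h w) x y <-> open_adj w (h * x)%g (h * y)%g.
Proof.
split=> -[e [exy we]].
  exists (translate_edge h e); split => //.
  by rewrite translate_edgeE exy image_setU !image_set1.
exists (translate_edge h^-1 e); split.
  by rewrite translate_edgeE exy image_setU !image_set1 !mulKg.
by rewrite /translate translate_edgeM mulgV translate_edge1.
Qed.

(** Reading a configuration through a translation moves its clusters by the
    inverse translation; with this convention no inverse appears. *)
Lemma conn_translate h w x y :
  conn (translate h w) x y <-> conn w (h * x)%g (h * y)%g.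
Proof.
split=> xy.
  apply: (conn_preserves (Q := fun z => conn w (h * x)%g (h * z)%g) _ xy);
    last exact: conn_refl.
  by move=> a b ab /open_adj_translate; exact: conn_step.
rewrite -(mulKg h y).
apply: (conn_preserves (Q := fun z => conn (translate h w) x (h^-1 * z)%g) _ xy);
  last by rewrite mulKg; exact: conn_refl.
move=> a b xa ab; apply: conn_step xa _.
by apply/open_adj_translate; rewrite !mulVKg.
Qed.

Definition translate_edges h B : {fset E} := [fset translate_edge h e | e in B]%fset.
Definition translate_vertices h V : {fset Gam} := [fset (h * v)%g | v in V]%fset.

Lemma mem_translate_edges h B e :
  (translate_edge h e \in translate_edges h B) = (e \in B).
Proof. by rewrite mem_imfset //; exact: translate_edge_inj. Qed.

Lemma mem_translate_vertices h V v :
  ((h * v)%g \in translate_vertices h V) = (v \in V).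
Proof. by rewrite mem_imfset //; exact: mulgI. Qed.

Lemma card_translate_edges h B : #|` translate_edges h B| = #|` B|.
Proof. by rewrite card_imfset //=; exact: translate_edge_inj. Qed.

Lemma set_edges_translate b B h w :
  set_edges b B (translate h w) = translate h (set_edges b (translate_edges h B) w).
Proof.
by apply/funext => e; rewrite /translate /set_edges mem_translate_edges.
Qed.

Lemma edges_open_translate B h w :
  edges_open B (translate h w) <-> edges_open (translate_edges h B) w.
Proof.
split=> wB e; last by move=> eB; apply: wB; rewrite mem_translate_edges.
by move=> /imfsetP[f /= fB ->]; exact: wB.
Qed.

Lemma pattern_translate h B V : pattern B V ->
  pattern (translate_edges h B) (translate_vertices h V).
Proof.
move=> [endB cB]; split=> [_ x /imfsetP[e /= eB ->]|w x y].
  rewrite translate_edgeE => -[z ez <-].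
  by rewrite mem_translate_vertices; exact: endB ez.
move=> wo /imfsetP[v /= vV ->] /imfsetP[u /= uV ->].
apply/conn_translate; apply: cB => //; exact: (edges_open_translate B h w).2 wo.
Qed.

(** * The branches left by closing one of two patterns *)

Lemma open_after_cut w B1 B2 : edges_open B2 w ->
  (forall e, e \in B1 -> e \in B2 -> False) ->
  edges_open B2 (set_edges false B1 w).
Proof.
move=> open2 disj e e2; rewrite /set_edges; case: ifP => [e1|_]; last exact: open2.
by case: (disj e e1 e2).
Qed.

(** A path that never meets [V2] uses no edge of [B2], so it survives the closing
    of [B2]; reopening [B1] does no harm. *)
Lemma conn_change_cut w B1 B2 V2 x y : pattern B2 V2 ->
  (forall v, v \in V2 -> ~ conn (set_edges false B1 w) x v) ->
  conn (set_edges false B1 w) x y -> conn (set_edges false B2 w) x y.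
Proof.
move=> pat2 no xy.
have : conn (set_edges false B2 (set_edges false B1 w)) x y.
  exact: (conn_avoiding pat2.1 (@off_set_edges B2 _) no xy).
apply: sub_conn => e; rewrite {1 3}/set_edges; case: ifP => // _.
exact: set_edges_closed_sub.
Qed.

(** Let [r] be the root of the cluster.  If the second pattern is not on the side
    of the root when [B1] is closed, then, when [B2] is closed, the whole first
    pattern is still joined to the root.  A branch [b] of the second pattern
    away from the root therefore avoids the first pattern, and so stays inside
    the branch of the first pattern that contains the second. *)
Lemma nested_branch w r B1 B2 V1 V2 (pat1 : pattern B1 V1) (pat2 : pattern B2 V2)
    (open1 : edges_open B1 w) (open2 : edges_open B2 w)
    (disj : forall e, e \in B1 -> e \in B2 -> False) v1 v2 b z :
  v1 \in V1 -> conn w v1 r ->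
  v2 \in V2 -> ~ conn (set_edges false B1 w) v2 r ->
  b \in V2 -> ~ conn (set_edges false B2 w) b r ->
  conn (set_edges false B2 w) b z -> conn (set_edges false B1 w) v2 z.
Proof.
move=> v1V v1r v2V nv2r bV nbr bz.
have disj' e : e \in B2 -> e \in B1 -> False by move=> e2 e1; exact: disj e1 e2.
have c2 : forall u, u \in V2 -> conn (set_edges false B1 w) v2 u.
  by move=> u uV; apply: pat2.2 => //; exact: open_after_cut.
have [u uV ur] : exists2 u, u \in V1 & conn (set_edges false B1 w) u r.
  by case: (last_exit pat1.1 (@off_set_edges B1 w) v1r) => [|[u []]]; [exists v1|exists u].
have u2r : conn (set_edges false B2 w) r u.
  apply: (conn_change_cut pat2) (conn_sym ur) => v vV rv.
  by apply: nv2r; apply: conn_trans (c2 v vV) _; exact: conn_sym.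
have bz1 : conn (set_edges false B1 w) b z.
  apply: (conn_change_cut pat1) bz => v vV bv; apply: nbr.
  apply: conn_trans bv _; apply: conn_trans (conn_sym u2r).
  by apply: pat1.2 => //; exact: open_after_cut.
exact: conn_trans (c2 b bV) bz1.
Qed.

(** If each pattern is on the root side of the other, then a branch of the first
    away from the root avoids the second pattern.  If it met a branch of the
    second, it would lie in it together with a vertex of the first pattern, and
    so that branch would contain the root. *)
Lemma disjoint_branches w r B1 B2 V1 V2 (pat2 : pattern B2 V2) a b z :
  (forall v, v \in V2 -> conn (set_edges false B1 w) v r) ->
  (forall v, v \in V1 -> conn (set_edges false B2 w) v r) ->
  a \in V1 -> ~ conn (set_edges false B1 w) a r ->
  ~ conn (set_edges false B2 w) b r ->
  conn (set_edges false B1 w) a z -> conn (set_edges false B2 w) b z -> False.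
Proof.
move=> r2 r1 aV nar nbr az bz; apply: nbr.
apply: conn_trans bz (conn_trans _ (r1 a aV)); apply: conn_sym.
apply: (conn_change_cut pat2) az => v vV av; apply: nar.
exact: conn_trans av (r2 v vV).
Qed.

End Surgery.

(** * Counting trifurcations in a fixed configuration *)

Section BranchPoints.
Variables (Gam : groupType) (S : {fset Gam}).
Local Notation E := (cayley_edges S).
Implicit Types (w : config S) (x y z h : Gam) (B : {fset E}) (V : {fset Gam}).

(** At most one of the three classes contains the root [r]. *)
Lemma two_of_three (C : Gam -> Gam -> Prop) (Q : Gam -> Prop) v1 v2 v3 r :
  (forall x y, C x y -> C y x) -> (forall x y z, C x y -> C y z -> C x z) ->
  ~ C v1 v2 -> ~ C v1 v3 -> ~ C v2 v3 ->
  Q v1 -> Q v2 -> Q v3 ->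
  exists a b, [/\ ~ C a b, ~ C a r, ~ C b r & Q a /\ Q b].
Proof.
move=> sy tr n12 n13 n23 q1 q2 q3.
have no u v : ~ C u v -> C u r -> ~ C v r.
  by move=> nuv ur vr; apply: nuv; exact: tr ur (sy _ _ vr).
have [c1|c1] := pselect (C v1 r).
  by exists v2, v3; split => //; exact: no c1.
have [c2|c2] := pselect (C v2 r); last by exists v1, v2.
by exists v1, v3; split => //; exact: no c2.
Qed.

(** The translates of the pattern by [x] and [y] can share a vertex only if
    [x^-1 * y] lies in this set. *)
Definition pattern_overlap V : {fset Gam} := [fset (u * v^-1)%g | u in V, v in V]%fset.

Lemma disjoint_translates B V x y : pattern B V ->
  (x^-1 * y)%g \notin pattern_overlap V ->
  forall e, e \in translate_edges x B -> e \in translate_edges y B -> False.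
Proof.
move=> [endB _] xy e /imfsetP[e1 /= e1B ->] /imfsetP[e2 /= e2B e12].
have [a ea] : exists a, set_val e1 a.
  have [a [b [_ e1E]]] := set_mem (valP e1).
  by exists a; rewrite (e1E : set_val e1 = _); left.
have : set_val (translate_edge x e1) (x * a)%g by exists a.
rewrite e12 => -[b eb yb].
move/negP: xy; apply; apply/imfset2P; exists a; first exact: endB ea.
exists b; first exact: endB eb.
by rewrite -[y](mulgK b) yb !mulgA mulVg mul1g.
Qed.

(** Pass to a subset [I] of [T] whose patterns are edge-disjoint, at the cost of
    the constant factor [#|pattern_overlap V|].  Choose a root in each cluster and,
    at each point of [I], two of the three branches that avoid the root.  The
    traces of these on [K] satisfy the hypotheses of laminar_card. *)
Lemma branch_points_card B V v1 v2 v3 (K T : {fset Gam}) (m : nat) w :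
  pattern B V -> v1 \in V -> v2 \in V -> v3 \in V -> (0 < m)%N ->
  (forall x, x \in T ->
     let w' := set_edges false B (translate x w) in
     let big v := (m <= #|` [fset k in K | `[< conn w' v (x^-1 * k)%g >]]%fset|)%N in
     [/\ edges_open B (translate x w), ~ conn w' v1 v2, ~ conn w' v1 v3,
         ~ conn w' v2 v3 & [/\ big v1, big v2 & big v3]]) ->
  (m * #|` T| <= #|` pattern_overlap V| * #|` K|)%N.
Proof.
move=> pB V1 V2 V3 m0 hT.
have ov1 : 1%g \in pattern_overlap V.
  by apply/imfset2P; exists v1 => //; exists v1 => //; rewrite mulgV.
have ovV x : x \in pattern_overlap V -> x^-1%g \in pattern_overlap V.
  move=> /imfset2P[u /= uV [v /= vV ->]].
  by apply/imfset2P; exists v => //; exists u => //; rewrite invgF.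
have [I [IT Isep Tcard]] := separated_subset T ov1 ovV.
suff Icard : (m * #|` I| <= #|` K|)%N.
  apply: (@leq_trans (m * (#|` pattern_overlap V| * #|` I|))).
    by rewrite leq_mul2l Tcard orbT.
  by rewrite mulnCA leq_mul2l Icard orbT.
pose cut x := set_edges false (translate_edges x B) w.
pose root x := xget 1%g (cluster_of w x).
have rootP x : conn w x (root x).
  by apply: (@xgetPex _ 1%g (cluster_of w x)); exists x; exact: conn_refl.
have rootE x y : conn w x y -> root x = root y by move=> /cluster_eq; rewrite /root => ->.
pose branch x v := [fset k in K | `[< conn (cut x) (x * v)%g k >]]%fset.
have inbranch x v k : (k \in branch x v) = (k \in K) && `[< conn (cut x) (x * v)%g k >].
  by rewrite !inE.
have cutE x u v : conn (set_edges false B (translate x w)) u v <->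
    conn (cut x) (x * u)%g (x * v)%g.
  by rewrite set_edges_translate; exact: conn_translate.
have branchE x v : [fset k in K | `[< conn (set_edges false B (translate x w)) v
    (x^-1 * k)%g >]]%fset = branch x v.
  apply/fsetP => k; rewrite inbranch !inE; congr (_ && _).
  by apply: asbool_equiv_eq; rewrite cutE mulVKg.
have [ab abP] : exists ab : Gam -> Gam * Gam, forall x, x \in I ->
   let a := (ab x).1 in let b := (ab x).2 in let rx := root (x * v1)%g in
   [/\ ~ conn (cut x) (x * a)%g (x * b)%g, ~ conn (cut x) (x * a)%g rx,
       ~ conn (cut x) (x * b)%g rx, a \in V /\ (m <= #|` branch x a|)%N
     & b \in V /\ (m <= #|` branch x b|)%N].
  suff h x : exists ab, x \in I ->
     let a := ab.1 in let b := ab.2 in let rx := root (x * v1)%g in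
     [/\ ~ conn (cut x) (x * a)%g (x * b)%g, ~ conn (cut x) (x * a)%g rx,
       ~ conn (cut x) (x * b)%g rx, a \in V /\ (m <= #|` branch x a|)%N
     & b \in V /\ (m <= #|` branch x b|)%N].
    have [ab abP] := choice h; by exists ab.
  have [xI|] := boolP (x \in I); last by move=> _; exists (1%g, 1%g).
  have [_ n12 n13 n23] := hT x (fsubsetP IT x xI).
  rewrite !branchE => -[b1 b2 b3].
  have [a [b [nab nar nbr [[aV abig] [bV bbig]]]]] :=
    @two_of_three (conn (set_edges false B (translate x w)))
     (fun v => v \in V /\ (m <= #|` branch x v|)%N) v1 v2 v3
     (x^-1 * root (x * v1)%g)%g
     (@conn_sym _ _ _) (fun p q r => @conn_trans _ _ _ q p r)
     n12 n13 n23 (conj V1 b1) (conj V2 b2) (conj V3 b3).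
  exists (a, b) => _ /=; split => //.
  - by move/cutE.
  - by move=> h; apply: nar; apply/cutE; rewrite mulVKg.
  - by move=> h; apply: nbr; apply/cutE; rewrite mulVKg.
pose A x := branch x (ab x).1; pose A' x := branch x (ab x).2.
apply: (@laminar_card _ _ m I A A' K m0).
  move=> x xI; have [nab _ _ [_ ba] [_ bb]] := abP x xI.
  split => //; try by apply/fsubsetP => k; rewrite inbranch => /andP[].
  apply/fdisjointP => k; rewrite !inbranch => /andP[-> /asboolP ak] /=.
  apply/asboolP => bk; apply: nab; apply: conn_trans ak _; exact: conn_sym.
have pat x : pattern (translate_edges x B) (translate_vertices x V).
  exact: pattern_translate.
have inV x v : v \in V -> (x * v)%g \in translate_vertices x V.
  by rewrite mem_translate_vertices.
have op x : x \in I -> edges_open (translate_edges x B) w.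
  move=> /(fsubsetP IT) /hT[xo _ _ _ _].
  by apply/edges_open_translate.
have inU x k : (k \in (A x `|` A' x)%fset) <-> k \in K /\ exists2 c,
    c = (ab x).1 \/ c = (ab x).2 & conn (cut x) (x * c)%g k.
  rewrite in_fsetU !inbranch; split.
    by move=> /orP[]/andP[-> /asboolP h]; split => //; eexists; try exact: h; [left|right].
  by move=> [-> [c [->|->] h]] /=; apply/orP; [left|right]; apply/asboolP.
have cP x c : x \in I -> c = (ab x).1 \/ c = (ab x).2 ->
    c \in V /\ ~ conn (cut x) (x * c)%g (root (x * v1)%g).
  by move=> /abP[_ na nb [aV _] [bV _]] [->|->].
have cutw x u v : conn (cut x) u v -> conn w u v.
  by apply: sub_conn => e; exact: set_edges_closed_sub.
have connV x u v : x \in I -> u \in V -> v \in V -> conn w (x * u)%g (x * v)%g.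
  by move=> xI uV vV; apply: (pat x).2; [exact: op|exact: inV|exact: inV].
(* The case in which the pattern at [y] lies away from the root, seen from [x]. *)
have nested x y : x \in I -> y \in I -> x <> y ->
    root (x * v1)%g = root (y * v1)%g ->
    ~ conn (cut x) (y * v1)%g (root (x * v1)%g) ->
    [\/ (A y `|` A' y `<=` A x)%fset, (A y `|` A' y `<=` A' x)%fset
      | [disjoint A x `|` A' x & A y `|` A' y]%fset].
  move=> xI yI xy rxy nr.
  have dis := disjoint_translates pB (Isep x y xI yI xy).
  have U k : k \in (A y `|` A' y)%fset -> k \in K /\ conn (cut x) (y * v1)%g k.
    move=> /inU[kK [c /(cP y c yI)[cV ncr] ck]]; split => //.
    rewrite -rxy in ncr.
    exact: (nested_branch (pat x) (pat y) (op x xI) (op y yI) dis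
      (inV x v1 V1) (rootP (x * v1)%g) (inV y v1 V1) nr (inV y c cV) ncr ck).
  have sub v : conn (cut x) (x * v)%g (y * v1)%g -> (A y `|` A' y `<=` branch x v)%fset.
    move=> vy; apply/fsubsetP => k /U[kK yk]; rewrite inbranch kK /=.
    by apply/asboolP; exact: conn_trans yk.
  have [h1|n1] := pselect (conn (cut x) (x * (ab x).1)%g (y * v1)%g).
    by apply: Or31; exact: sub.
  have [h2|n2] := pselect (conn (cut x) (x * (ab x).2)%g (y * v1)%g).
    by apply: Or32; exact: sub.
  apply: Or33; rewrite fdisjoint_sym; apply/fdisjointP => k /U[_ yk].
  apply/negP => /inU[_ [c cE ck]].
  have : conn (cut x) (x * c)%g (y * v1)%g by apply: conn_trans ck _; exact: conn_sym.
  by case: cE => ->.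
move=> x y xI yI xy /=.
have dis := disjoint_translates pB (Isep x y xI yI xy).
have [rxy|nrxy] := pselect (root (x * v1)%g = root (y * v1)%g); last first.
  apply: Or33; apply/fdisjointP => k /inU[_ [c /(cP x c xI)[cV _] ck]].
  apply/negP => /inU[_ [d /(cP y d yI)[dV _] dk]]; apply: nrxy.
  rewrite (rootE _ _ (conn_trans (connV x v1 c xI V1 cV) (cutw _ _ _ ck))).
  by rewrite (rootE _ _ (conn_trans (connV y v1 d yI V1 dV) (cutw _ _ _ dk))).
have [cyx|nyx] := pselect (conn (cut x) (y * v1)%g (root (x * v1)%g)); last first.
  case: (nested x y xI yI xy rxy nyx) => h.
  - by apply: Or32; left.
  - by apply: Or32; right.
  - exact: Or33.
have [cxy|nxy] := pselect (conn (cut y) (x * v1)%g (root (y * v1)%g)); last first.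
  case: (nested y x yI xI (nesym xy) (esym rxy) nxy) => h.
  - by apply: Or31; left.
  - by apply: Or31; right.
  - by apply: Or33; rewrite fdisjoint_sym.
(* The remaining case: each pattern lies on the root side of the other. *)
have dis' e : e \in translate_edges y B -> e \in translate_edges x B -> False.
  by move=> e1 e2; exact: dis e2 e1.
apply: Or33; apply/fdisjointP => k /inU[_ [c /(cP x c xI)[cV ncr] ck]].
apply/negP => /inU[_ [d /(cP y d yI)[dV ndr] dk]].
apply: (disjoint_branches (pat y) _ _ (inV x c cV) ncr _ ck dk).
- move=> v vV; apply: conn_trans cyx; apply: (pat y).2 => //; last exact: inV.
  by apply: open_after_cut => //; exact: op.
- move=> v vV; rewrite rxy; apply: conn_trans cxy; apply: (pat x).2 => //; last exact: inV.
  by apply: open_after_cut => //; exact: op.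
- by rewrite rxy.
Qed.

End BranchPoints.

(** * Means of indicators and independence *)

Section Generic.
Context d (T : measurableType d) (R : realType) (P : probability T R).

(** Additivity of the integral requires integrability, so the two are recorded
    together. *)
Definition has_mean (f : T -> R) (v : R) : Prop :=
  P.-integrable setT (EFin \o f) /\ (\int[P]_w (f w)%:E = v%:E)%E.

Lemma has_mean_indic (A : set T) : measurable A -> has_mean \1_A (fine (P A)).
Proof.
move=> mA; split; first exact: integrable_indic.
by rewrite integral_indic // setIT fineK // fin_num_measure.
Qed.

Lemma has_meanD f g u v : has_mean f u -> has_mean g v ->
  has_mean (fun w => f w + g w) (u + v).
Proof.
move=> [fi fe] [gi ge]; split; first exact: (integrableD measurableT fi gi).
under eq_integral do rewrite EFinD.
by rewrite integralD //= fe ge.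
Qed.

Lemma has_meanZ c f u : has_mean f u -> has_mean (fun w => c * f w) (c * u).
Proof.
move=> [fi fe]; split; first exact: (integrableZl measurableT c fi).
under eq_integral do rewrite EFinM.
by rewrite integralZl // fe.
Qed.

Lemma has_mean_cst c : has_mean (fun=> c) c.
Proof.
have := has_meanZ c (has_mean_indic measurableT).
rewrite probability_setT /= mulr1; congr has_mean.
by apply/funext => w; rewrite indicT mulr1.
Qed.

Lemma has_mean_sum (I : eqType) (r : seq I) (f : I -> T -> R) (u : I -> R) :
  (forall i, i \in r -> has_mean (f i) (u i)) ->
  has_mean (fun w => \sum_(i <- r) f i w) (\sum_(i <- r) u i).
Proof.
elim: r => [|i r IH] h.
  rewrite big_nil; under eq_fun do rewrite big_nil; exact: has_mean_cst.
rewrite big_cons; under eq_fun do rewrite big_cons.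
apply: has_meanD; first by apply: h; rewrite mem_head.
by apply: IH => j jr; apply: h; rewrite in_cons jr orbT.
Qed.

Lemma has_mean_ge0 f u : has_mean f u -> (forall w, 0 <= f w) -> 0 <= u.
Proof.
by move=> [_ fe] f0; rewrite -lee_fin -fe; apply: integral_ge0 => w _; rewrite lee_fin.
Qed.

Lemma prob_bigcup_cvg (F : (set T)^nat) : (forall n, measurable (F n)) ->
  {homo F : n m / (n <= m)%N >-> (n <= m)%O} ->
  fine (P (F n)) @[n --> \oo] --> fine (P (\bigcup_n F n)).
Proof.
move=> mF ndF; have mU := bigcupT_measurable F mF.
by apply: fine_cvg; rewrite fineK ?fin_num_measure //; exact: nondecreasing_cvg_mu.
Qed.

(** The sets that satisfy the conclusion form a lambda-system, so it suffices to
    check it on a generating pi-system.  With [C] the whole space this identifies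
    laws; with [f = g] it is independence of [C] and the preimages under [f]. *)
Lemma eq_preimage_prob (G : set (set T)) (C : set T) (q : R)
    (f g : T -> T) :
  measurable = <<s G >> -> setI_closed G -> measurable C ->
  measurable_fun setT f -> measurable_fun setT g ->
  fine (P C) = q ->
  (forall A, G A -> fine (P (C `&` f @^-1` A)) = q * fine (P (g @^-1` A))) ->
  forall A, measurable A -> fine (P (C `&` f @^-1` A)) = q * fine (P (g @^-1` A)).
Proof.
move=> GE GI mC mf mg qC hG.
have mpre (h : T -> T) (A : set T) : measurable_fun setT h -> measurable A -> measurable (h @^-1` A).
  by move=> mh mA; rewrite -[X in measurable X]setTI; exact: mh.
pose H := [set A | measurable A /\
  fine (P (C `&` f @^-1` A)) = q * fine (P (g @^-1` A))].
have PD (A B : set T) : measurable A -> measurable B -> B `<=` A ->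
    fine (P (A `\` B)) = fine (P A) - fine (P B).
  move=> mA mB BA; rewrite measureD ?(fin_num_fun_lty (fin_num_measure P _)) //=.
    by rewrite (setIidr BA) fineB ?fin_num_measure.
  by rewrite ltey_eq fin_num_measure.
suff : measurable `<=` H by move=> h A /h[].
rewrite GE; apply: lambda_system_subset => //.
- split => //.
  + by split => //; rewrite !preimage_setT setIT probability_setT qC mulr1.
  + move=> A B BA [mA hA] [mB hB]; split; first exact: measurableD.
    have -> : g @^-1` (A `\` B) = g @^-1` A `\` g @^-1` B by [].
    have -> : C `&` f @^-1` (A `\` B) = (C `&` f @^-1` A) `\` (C `&` f @^-1` B).
      by apply/seteqP; split=> w /=; tauto.
    rewrite !PD; do ?[exact: mpre | by apply: measurableI => //; exact: mpre].
    * by rewrite hA hB mulrBr.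
    * by move=> w /= /BA.
    * by move=> w /= [? /BA].
  + move=> F ndF hF.
    have mF n : measurable (F n) by have [] := hF n.
    split; first exact: bigcupT_measurable.
    rewrite !preimage_bigcup setI_bigcupr.
    have c1 := @prob_bigcup_cvg (fun n => C `&` f @^-1` F n)
      (fun n => measurableI _ _ mC (mpre _ _ mf (mF n))) _.
    have {}c1 : fine (P (C `&` f @^-1` F n)) @[n --> \oo] -->
        fine (P (\bigcup_n (C `&` f @^-1` F n))).
      apply: c1 => n m nm; apply/subsetPset => w /= [? Fw]; split => //.
      by move: (f w) Fw; apply/subsetPset; exact: ndF.
    have c2 : fine (P (g @^-1` F n)) @[n --> \oo] -->
        fine (P (\bigcup_n (g @^-1` F n))).
      apply: prob_bigcup_cvg => [n|n m nm]; first exact: mpre.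
      by apply/subsetPset => w /=; move: (g w); apply/subsetPset; exact: ndF.
    have eqF : (fun n => fine (P (C `&` f @^-1` F n))) =
        (fun n => q * fine (P (g @^-1` F n))).
      by apply/funext => n; have [] := hF n.
    rewrite eqF in c1.
    exact: (cvg_unique (@norm_hausdorff _ _) c1 (cvgMl_tmp (a := q) c2)).
- by move=> A GA; split; [rewrite GE; exact: sub_sigma_algebra|exact: hG].
Qed.

End Generic.

(** * Percolation events and their probabilities *)

Section PercolationEvents.
Variables (Gam : groupType) (S : {fset Gam}).
Local Notation E := (cayley_edges S).
Hypothesis genS : generated [set` S] = [set: Gam].
Implicit Types (w : config S) (x y z h : Gam) (B : {fset E}).

Lemma measurable_edge (e : E) : measurable [set w : config S | w e].
Proof. by apply: sub_sigma_algebra; exists e. Qed.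

Lemma measurable_exists (Q : Gam -> set (config S)) :
  (forall x, measurable (Q x)) -> measurable [set w | exists x, Q x w].
Proof.
move=> mQ; have [g gP] := group_enum genS.
rewrite (_ : mkset _ = \bigcup_n Q (g n)); first exact: bigcupT_measurable.
apply/seteqP; split=> w /= [].
  by move=> x; have [n <-] := gP x; exists n.
by move=> n _ Qn; exists (g n).
Qed.

Lemma measurable_and (Q : Prop) (A : set (config S)) :
  measurable A -> measurable [set w | Q /\ A w].
Proof.
move=> mA; have [q|nq] := pselect Q.
  by rewrite (_ : mkset _ = A) //; apply/seteqP; split=> w //= [].
by rewrite (_ : mkset _ = set0) //; apply/seteqP; split=> w //= [].
Qed.

Lemma measurable_open_adj x y : measurable [set w : config S | open_adj w x y].
Proof.
have [[e eE]|ne] := pselect (exists e : E, set_val e = [set x; y]).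
  rewrite (_ : mkset _ = [set w : config S | w e]); first exact: measurable_edge.
  apply/seteqP; split=> w /=; last by exists e.
  by move=> [f [fE wf]]; rewrite (_ : e = f) //; apply: edge_inj; rewrite eE.
rewrite (_ : mkset _ = set0) //; apply/seteqP; split=> w //= -[e [eE _]].
by apply: ne; exists e.
Qed.

Lemma measurable_conn x y : measurable [set w : config S | conn w x y].
Proof.
pose step (Q : Gam -> set (config S)) z : set (config S) :=
  [set w | exists u, Q u w /\ open_adj w u z].
pose Q n := iter n step (fun z => [set w | x = z]).
have mQ n z : measurable (Q n z).
  elim: n z => [|n IH] z /=.
    rewrite (_ : mkset _ = [set w : config S | x = z /\ setT w]); first exact: measurable_and.
    by apply/seteqP; split=> w //= -[].
  apply: measurable_exists => u; apply: measurableI; first exact: IH.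
  exact: measurable_open_adj.
rewrite (_ : mkset _ = \bigcup_n Q n y); first exact: bigcupT_measurable.
apply/seteqP; split=> w /=.
  move=> xy; apply: (conn_preserves (Q := fun z => (\bigcup_n Q n z) w) _ xy); last by exists 0%N.
  by move=> a b [n _ Qa] ab; exists n.+1 => //; exists a.
move=> [n _]; elim: n y => [|n IH] y /=; first by move=> ->; exact: conn_refl.
by move=> [u [/IH xu uy]]; exact: conn_step uy.
Qed.

(** A set of group elements is infinite iff for every [n] it has an element that
    is not among the first [n] terms of the enumeration; this leaves only countable
    operations. *)
Lemma measurable_infinite_at (H : set Gam) x :
  measurable [set w : config S | infinite_at H w x].
Proof.
have [g gP] := group_enum genS.
rewrite (_ : mkset _ = \bigcap_n [set w | exists y,
   (H y /\ (forall k, (k < n)%N -> g k <> y)) /\ conn w x y]).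
  apply: bigcapT_measurable => n; apply: measurable_exists => y.
  by apply: measurable_and; exact: measurable_conn.
apply/seteqP; split=> w /=.
  move=> inf n _; apply: contrapT => no; apply: inf.
  apply: (@sub_finite_set _ _ (g @` `I_n)); last exact: finite_image.
  move=> y [xy Hy]; apply: contrapT => ny; apply: no; exists y; split => //.
  by split => // k kn gk; apply: ny; exists k.
move=> h fin.
have [n nP] : exists n, forall y, (cluster_of w x `&` H) y -> exists2 k, (k < n)%N & g k = y.
  have [s sE] := (finite_seqP _).1 fin.
  by have [n nP] := enum_bound s gP; exists n => y; rewrite sE => /nP.
have [y [[Hy ny] xy]] := h n I.
by have [k kn gk] := nP y (conj xy Hy); exact: (ny k kn gk).
Qed.

Lemma measurable_edges_open B : measurable [set w : config S | edges_open B w].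
Proof.
rewrite (_ : mkset _ = \big[setI/setT]_(e <- B) [set w : config S | w e]).
  by apply: bigsetI_measurable => e _; exact: measurable_edge.
rewrite -bigcap_seq; apply/seteqP; split=> w /= h e; exact: h.
Qed.

Lemma measurable_config_fun (f : config S -> config S) :
  (forall e, measurable [set w | f w e]) -> measurable_fun setT f.
Proof.
move=> mf; apply: (@measurability _ _ (config S) (config S) _ f
    (range (@edge_open Gam S) : set (set (config S)))) => //.
move=> _ [_ [e _ <-] <-]; rewrite setTI; exact: mf.
Qed.

Lemma measurable_translate h : measurable_fun setT (@translate Gam S h).
Proof. by apply: measurable_config_fun => e; exact: measurable_edge. Qed.

Lemma measurable_set_edges b B : measurable_fun setT (@set_edges Gam S b B).
Proof.
apply: measurable_config_fun => e; rewrite /set_edges.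
case eB: (e \in B); last exact: measurable_edge.
case: b.
  by rewrite (_ : mkset _ = setT) //; apply/seteqP; split.
by rewrite (_ : mkset _ = set0) //; apply/seteqP; split.
Qed.

Lemma measurable_preimage (f : config S -> config S) A :
  measurable_fun setT f -> measurable A -> measurable (f @^-1` A).
Proof. by move=> mf mA; rewrite -[X in measurable X]setTI; exact: mf. Qed.

Section Law.
Variables (R : realType) (p : R) (P : probability (config S) R).
Hypothesis hP : bernoulli_percolation p P.

Definition open_event B : set (config S) := [set w | edges_open B w].

Lemma prob_open B : fine (P (open_event B)) = p ^+ #|` B|.
Proof.
rewrite (_ : open_event B = [set w : config S | forall e, e \in B -> w e = true]) //.
by rewrite (hP B (fun=> true)) /= big_const_seq count_predT iter_mulr_1.
Qed.

Lemma open_eventU B B' : open_event B `&` open_event B' = open_event (B `|` B')%fset.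
Proof.
apply/seteqP; split=> w /=.
  by move=> [h h'] e; rewrite in_fsetU => /orP[]; [exact: h|exact: h'].
by move=> h; split=> e eB; apply: h; rewrite in_fsetU eB ?orbT.
Qed.

Lemma open_event_translate h B :
  translate h @^-1` open_event B = open_event (translate_edges h B).
Proof.
apply/seteqP; split=> w ow; first exact: (edges_open_translate B h w).1 ow.
exact: (edges_open_translate B h w).2 ow.
Qed.

(** Together with open_eventI_closed this reduces the comparison of laws to events
    whose probability is given by prob_open. *)
Lemma open_event_gen : measurable = <<s range open_event >> :> set (set (config S)).
Proof.
have -> : measurable = <<s range (@edge_open Gam S) >> :> set (set (config S)) by [].
apply/seteqP; split.
  apply: sub_sigma_algebra2 => _ [e _ <-]; exists [fset e]%fset => //.
  apply/seteqP; split=> w /=; first by apply; rewrite in_fset1.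
  by move=> we f; rewrite in_fset1 => /eqP ->.
apply: smallest_sub; first exact: sigma_algebra_measurable.
by move=> _ [B _ <-]; exact: measurable_edges_open.
Qed.

Lemma open_eventI_closed : setI_closed (range open_event).
Proof. by move=> _ _ [B _ <-] [B' _ <-]; rewrite open_eventU; eexists. Qed.

Lemma prob_translate h A : measurable A ->
  fine (P (translate h @^-1` A)) = fine (P A).
Proof.
move=> mA; have := @eq_preimage_prob _ _ _ P _ setT 1 (translate h) id
  open_event_gen open_eventI_closed (@measurableT _ _) (measurable_translate h)
  (@measurable_id _ _ _) _ _ A mA.
rewrite setTI mul1r; apply; first by rewrite probability_setT.
move=> _ [B _ <-]; rewrite setTI mul1r.
by rewrite open_event_translate !prob_open card_translate_edges.
Qed.

(** Independence of the edges inside and outside [B]: the event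
    [set_edges b B @^-1` A] depends on the latter only. *)
Lemma prob_open_set_edges b B A : measurable A ->
  fine (P (open_event B `&` set_edges b B @^-1` A)) =
  p ^+ #|` B| * fine (P (set_edges b B @^-1` A)).
Proof.
apply: (eq_preimage_prob open_event_gen open_eventI_closed).
- exact: measurable_edges_open.
- exact: measurable_set_edges.
- exact: measurable_set_edges.
- exact: prob_open.
move=> _ [F _ <-]; case: b.
  rewrite (_ : _ @^-1` _ = open_event (F `\` B)%fset); last first.
    apply/seteqP; split=> w /= h e.
      by rewrite in_fsetD => /andP[eB /h]; rewrite /set_edges (negbTE eB).
    rewrite /set_edges; case: ifP => // eB eF; apply: h.
    by rewrite in_fsetD eB.
  rewrite open_eventU !prob_open -exprD; congr (_ ^+ _).
  rewrite cardfsU (_ : B `&` (F `\` B) = fset0)%fset ?cardfs0 ?subn0 //.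
  by apply/fsetP => e; rewrite in_fsetI in_fsetD in_fset0; case: (e \in B).
have [[e [eF eB]]|no] := pselect (exists e, e \in F /\ e \in B).
  rewrite (_ : _ @^-1` _ = set0) ?setI0 ?measure0 ?mulr0 //.
  by apply/seteqP; split=> w //= /(_ e eF); rewrite /set_edges eB.
have nB e : e \in F -> e \in B = false.
  by move=> eF; apply/negP => eB; apply: no; exists e.
rewrite (_ : _ @^-1` _ = open_event F); last first.
  by apply/seteqP; split=> w /= h e eF; move: (h e eF); rewrite /set_edges nB.
rewrite open_eventU !prob_open -exprD; congr (_ ^+ _).
rewrite cardfsU (_ : B `&` F = fset0)%fset ?cardfs0 ?subn0 //.
apply/fsetP => e; rewrite in_fsetI in_fset0; apply/negP => /andP[eB /nB].
by rewrite eB.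
Qed.

End Law.
End PercolationEvents.

(** * Invariant events and open patterns *)

Section Mixing.
Variables (Gam : groupType) (S : {fset Gam}).
Local Notation E := (cayley_edges S).
Implicit Types (w : config S) (x y z h : Gam) (B : {fset E}) (H : set Gam).

(** The translates that overlap one of the first [n] are given by a finite set,
    which cannot exhaust [H]. *)
Lemma disjoint_translates_exist H B (V : {fset Gam}) (n : nat) :
  infinite_set H -> pattern B V ->
  exists h : nat -> Gam, (forall i, (i < n)%N -> H (h i)) /\
    forall i j, (i < n)%N -> (j < n)%N -> i <> j ->
      (translate_edges (h i) B `&` translate_edges (h j) B = fset0)%fset.
Proof.
move=> infH pB; elim: n => [|n [h [hH hd]]]; first by exists (fun=> 1%g).
pose X := [set z | exists2 i, (i < n)%N & ((h i)^-1 * z)%g \in pattern_overlap V].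
have finX : finite_set X.
  have -> : X = \bigcup_(i in `I_n) [set (h i * u)%g | u in [set` pattern_overlap V]].
    apply/seteqP; split=> z /=.
      by move=> [i ni iz]; exists i => //; exists ((h i)^-1 * z)%g => //; rewrite mulVKg.
    by move=> [i ni [u uV <-]]; exists i => //; rewrite mulKg.
  by apply: bigcup_finite => // i _; exact: finite_image.
have [z Hz nXz] : exists2 z, H z & ~ X z.
  apply: contrapT => no; apply: infH; apply: sub_finite_set finX => z Hz.
  by apply: contrapT => nX; apply: no; exists z.
have zd i : (i < n)%N -> (translate_edges (h i) B `&` translate_edges z B = fset0)%fset.
  move=> ni; apply/fsetP => e; rewrite in_fsetI in_fset0; apply/negP => /andP[e1 e2].
  apply: (disjoint_translates pB _ e1 e2); apply/negP => iz; apply: nXz.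
  by exists i.
exists (fun i => if (i < n)%N then h i else z); split.
  by move=> i _; case: ifP => // /hH.
move=> i j; rewrite !ltnS => ni nj ij.
case: ifP => ci; case: ifP => cj.
- exact: hd.
- exact: zd.
- by rewrite fsetIC; exact: zd.
- case: ij; apply/eqP; rewrite eqn_leq; move: ci cj; rewrite !ltnNge.
  move=> /negbFE ci /negbFE cj.
  by rewrite (leq_trans ni cj) (leq_trans nj ci).
Qed.

Section Law.
Variables (R : realType) (p : R) (P : probability (config S) R).
Hypothesis p01 : 0 <= p <= 1.
Hypothesis hP : bernoulli_percolation p P.

(** Let [X] count the open patterns among [n] edge-disjoint translates of [B] by
    elements of [H], and let [q] be the probability that [B] is open.  The
    variance of [X] is at most [n], while by invariance of [A] the integral of
    [X - n q] over [A] is [n] times the difference of the two sides.  By the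
    Cauchy-Schwarz inequality the square of the difference is at most [1 / n],
    for every [n]. *)
Lemma invariant_open_ge H A B (V : {fset Gam}) :
  infinite_set H -> pattern B V -> measurable A ->
  (forall h, H h -> translate h @^-1` A = A) ->
  p ^+ #|` B| * fine (P A) <= fine (P (open_event B `&` A)).
Proof.
move=> infH pB mA invA.
set q := p ^+ #|` B|; set a := fine (P (open_event B `&` A)).
have mO B' : measurable (open_event B') by exact: measurable_edges_open.
have q0 : 0 <= q by apply: exprn_ge0; case/andP: p01.
have q1 : q <= 1 by apply: exprn_ile1; case/andP: p01.
rewrite leNgt; apply/negP => lt_a.
pose dlt := q * fine (P A) - a.
have d0 : 0 < dlt by rewrite subr_gt0.
suff bound n : (0 < n)%N -> dlt ^+ 2 * n%:R <= 1.
  have [n nd] : exists n : nat, dlt ^- 2 < n%:R.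
    by exists (Num.bound (dlt ^- 2)); apply: archi_boundP; rewrite invr_ge0 exprn_ge0 // ltW.
  have n0 : (0 < n)%N by rewrite -(ltr0n R); apply: lt_trans nd; rewrite invr_gt0 exprn_gt0.
  have := bound n n0; apply/negP; rewrite -ltNge.
  by rewrite mulrC -ltr_pdivrMr ?exprn_gt0 // div1r.
move=> n0.
have [h [hH hd]] := disjoint_translates_exist n infH pB.
pose O i := open_event (translate_edges (h i) B).
have OE i : O i = translate (h i) @^-1` (open_event B).
  by rewrite open_event_translate.
have PO i : fine (P (O i)) = q.
  by rewrite (prob_open hP) card_translate_edges.
have POA i : (i < n)%N -> fine (P (O i `&` A)) = a.
  move=> ni; rewrite OE -[X in _ `&` X](invA (h i) (hH i ni)) -preimage_setI.
  by rewrite (prob_translate hP) //; exact: measurableI.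
have POO i j : (i < n)%N -> (j < n)%N -> i <> j -> fine (P (O i `&` O j)) = q ^+ 2.
  move=> ni nj ij; rewrite /O open_eventU (prob_open hP) cardfsU hd // cardfs0 subn0.
  by rewrite exprD !card_translate_edges.
(* With this [t] the mean of [F] is at most [n - (dlt * n) ^+ 2]. *)
pose t := dlt * n%:R : R.
pose N := n%:R : R.
(* [F] is [2 t 1_A (X - N q) + t^2 + (X - N q)^2], which is nonnegative. *)
pose F w := 2 * t * (\sum_(i <- iota 0 n) \1_(O i `&` A) w + (- (N * q)) * \1_A w)
  + (t ^+ 2 + (\sum_(i <- iota 0 n) \sum_(j <- iota 0 n) \1_(O i `&` O j) w
     + ((- (2 * (N * q))) * (\sum_(i <- iota 0 n) \1_(O i) w) + (N * q) ^+ 2))).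
have lt_n i : i \in iota 0 n -> (i < n)%N by rewrite mem_iota.
have hF : has_mean P F (2 * t * (\sum_(i <- iota 0 n) a + (- (N * q)) * fine (P A))
  + (t ^+ 2 + (\sum_(i <- iota 0 n) \sum_(j <- iota 0 n) (if i == j then q else q ^+ 2)
     + ((- (2 * (N * q))) * (\sum_(i <- iota 0 n) q) + (N * q) ^+ 2)))).
  apply: has_meanD.
    apply: has_meanZ; apply: has_meanD; last first.
      by apply: has_meanZ; exact: has_mean_indic.
    apply: has_mean_sum => i /lt_n ni; rewrite -(POA i ni).
    by apply: has_mean_indic; apply: measurableI => //; exact: mO.
  apply: has_meanD; first exact: has_mean_cst.
  apply: has_meanD.
    apply: has_mean_sum => i /lt_n ni; apply: has_mean_sum => j /lt_n nj.
    case: eqP => [<-|ij]; first by rewrite setIid -(PO i); apply: has_mean_indic; exact: mO.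
    by rewrite -(POO i j ni nj ij); apply: has_mean_indic; apply: measurableI; exact: mO.
  apply: has_meanD; last exact: has_mean_cst.
  apply: has_meanZ; apply: has_mean_sum => i _; rewrite -(PO i); apply: has_mean_indic; exact: mO.
have F0 w : 0 <= F w.
  rewrite /F; set X := \sum_(i <- iota 0 n) \1_(O i) w.
  have -> : \sum_(i <- iota 0 n) \1_(O i `&` A) w = X * \1_A w.
    by rewrite mulr_suml; apply: eq_bigr => i _; rewrite indicI.
  have -> : \sum_(i <- iota 0 n) \sum_(j <- iota 0 n) \1_(O i `&` O j) w = X ^+ 2.
    rewrite expr2 mulr_suml; apply: eq_bigr => i _; rewrite mulr_sumr.
    by apply: eq_bigr => j _; rewrite indicI.
  rewrite indicE; case: (w \in A) => /=.
    by have := sqr_ge0 (t + (X - N * q)); congr (_ <= _); ring.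
  have := addr_ge0 (sqr_ge0 t) (sqr_ge0 (X - N * q)); congr (_ <= _); ring.
have := has_mean_ge0 hF F0.
have sumN (c : R) : \sum_(i <- iota 0 n) c = N * c.
  by rewrite big_const_seq count_predT size_iota iter_addr_0 -mulr_natl.
have -> : \sum_(i <- iota 0 n) \sum_(j <- iota 0 n) (if i == j then q else q ^+ 2)
    = N * (q - q ^+ 2 + N * q ^+ 2).
  rewrite -sumN big_seq [RHS]big_seq; apply: eq_bigr => i iI.
  rewrite -(sumN (q ^+ 2)).
  rewrite (bigD1_seq i) ?iota_uniq //= eqxx [in RHS](bigD1_seq i) ?iota_uniq //=.
  rewrite addrA subrK; congr (_ + _); apply: eq_bigr => j.
  by rewrite eq_sym => /negbTE ->.
rewrite !sumN => main.
have N0 : 0 < N by rewrite ltr0n.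
have key : 0 <= - dlt ^+ 2 * N ^+ 2 + N * (q - q ^+ 2).
  move: main; congr (_ <= _); rewrite /t -/N /dlt; ring.
have qq : q - q ^+ 2 <= 1 by nra.
have : 0 <= N * (1 - dlt ^+ 2 * N) by nra.
by rewrite pmulr_rge0 // subr_ge0.
Qed.

End Law.
End Mixing.

(** * From two infinite clusters to three *)

Section Clusters.
Variables (Gam : groupType) (S : {fset Gam}).
Local Notation E := (cayley_edges S).
Hypothesis genS : generated [set` S] = [set: Gam].
Variable H : set Gam.
Hypothesis sgH : subgroup H.
Implicit Types (w : config S) (x y z h : Gam) (B : {fset E}).

Definition two_clusters w x y : Prop :=
  [/\ ~ conn w x y, infinite_at H w x & infinite_at H w y].

Definition three_clusters w x y z : Prop :=
  [/\ two_clusters w x y, two_clusters w x z & two_clusters w y z].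

Definition nonunique : set (config S) := [set w | exists x y, two_clusters w x y].

Lemma subgroupV h : H h -> H h^-1%g.
Proof.
move=> Hh; have := sgH.2 1%g h; rewrite !inE mul1g; apply => //.
by have := sgH.1; rewrite inE.
Qed.

Lemma subgroupM h k : H h -> H k -> H (h * k)%g.
Proof.
by move=> Hh /subgroupV Hk; have := sgH.2 h k^-1%g; rewrite !inE invgK; apply.
Qed.

Lemma infinite_at_translate h w x : H h ->
  infinite_at H (translate h w) x <-> infinite_at H w (h * x)%g.
Proof.
move=> Hh; split=> inf fin; apply: inf.
  apply: (@sub_finite_set _ _ ((fun y => h^-1 * y)%g @` (cluster_of w (h * x)%g `&` H))).
    move=> y [xy Hy]; exists (h * y)%g; last by rewrite mulKg.
    by split; [exact/conn_translate|exact: subgroupM].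
  exact: finite_image.
apply: (@sub_finite_set _ _ ((fun y => h * y)%g @` (cluster_of (translate h w) x `&` H))).
  move=> y [xy Hy]; exists (h^-1 * y)%g; last by rewrite mulVKg.
  split; last exact: subgroupM (subgroupV Hh) Hy.
  by apply/conn_translate; rewrite mulVKg.
exact: finite_image.
Qed.

Lemma nonunique_invariant h : H h -> translate h @^-1` nonunique = nonunique.
Proof.
move=> Hh; apply/seteqP; split=> w /= [x [y [nxy ix iy]]].
  exists (h * x)%g, (h * y)%g; split; try exact/infinite_at_translate.
  by move=> xy; apply: nxy; apply/conn_translate.
exists (h^-1 * x)%g, (h^-1 * y)%g; split.
- by move=> /(conn_translate h); rewrite !mulVKg.
- by apply/infinite_at_translate; rewrite ?mulVKg.
- by apply/infinite_at_translate; rewrite ?mulVKg.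
Qed.

Lemma measurable_two_clusters x y : measurable [set w | two_clusters w x y].
Proof.
rewrite (_ : mkset _ = ~` [set w | conn w x y] `&`
    ([set w | infinite_at H w x] `&` [set w | infinite_at H w y])); last first.
  by apply/seteqP; split=> w /=; [case|move=> [? []]].
apply: measurableI; first by apply: measurableC; exact: measurable_conn.
by apply: measurableI; exact: measurable_infinite_at.
Qed.

Lemma measurable_three_clusters x y z : measurable [set w | three_clusters w x y z].
Proof.
rewrite (_ : mkset _ = [set w | two_clusters w x y] `&`
    ([set w | two_clusters w x z] `&` [set w | two_clusters w y z])); last first.
  by apply/seteqP; split=> w /=; [case|move=> [? []]].
by apply: measurableI; [|apply: measurableI]; exact: measurable_two_clusters.
Qed.

Lemma measurable_nonunique : measurable nonunique.
Proof.
apply: (measurable_exists genS) => x; apply: (measurable_exists genS) => y.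
exact: measurable_two_clusters.
Qed.

(** Opening edges merges clusters, and each [H]-infinite cluster of the new
    configuration contains one of the old. *)
Lemma nonunique_set_open B (V : {fset Gam}) w : pattern B V ->
  nonunique (set_edges true B w) -> nonunique w.
Proof.
move=> [endB _] [x [y [nxy ix iy]]].
have [u [_ xu iu]] := infinite_branch endB (@set_edges_off _ _ true B w) ix.
have [v [_ yv iv]] := infinite_branch endB (@set_edges_off _ _ true B w) iy.
exists u, v; split => // uv; apply: nxy; apply: conn_trans xu _.
apply: conn_trans (conn_sym yv).
by apply: sub_conn uv => e; exact: set_edges_open_sub.
Qed.

(** Opening [B] joins the clusters of [x] and [y].  If an [H]-infinite cluster
    other than the joint one remains, it contains an [H]-infinite cluster of
    [w], which differs from those of [x] and [y]. *)
Lemma third_cluster B (V : {fset Gam}) w x y : pattern B V -> x \in V -> y \in V ->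
  two_clusters w x y -> nonunique (set_edges true B w) ->
  exists z, three_clusters w x y z.
Proof.
move=> [endB cB] xV yV [nxy ix iy] [a [b [nab ia ib]]].
set w' := set_edges true B w in nab ia ib.
have oB : edges_open B w' by move=> e eB; rewrite /w' /set_edges eB.
have [c nxc ic] : exists2 c, ~ conn w' x c & infinite_at H w' c.
  have [xa|nxa] := pselect (conn w' x a); last by exists a.
  exists b => // xb; apply: nab; apply: conn_trans xb; exact: conn_sym.
have [z [_ cz iz]] := infinite_branch endB (@set_edges_off _ _ true B w) ic.
have nz u : u \in V -> ~ conn w u z.
  move=> uV uz; apply: nxc; apply: conn_trans (cB w' x u oB xV uV) _.
  apply: conn_trans (conn_sym cz).
  by apply: sub_conn uz => e; exact: set_edges_open_sub.
by exists z; split; split => //; exact: nz.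
Qed.

Lemma three_branches B (V : {fset Gam}) w x y z : pattern B V ->
  x \in V -> y \in V -> z \in V -> three_clusters w x y z ->
  exists x' y' z', [/\ x' \in V, y' \in V, z' \in V &
    three_clusters (set_edges false B w) x' y' z'].
Proof.
move=> [endB _] xV yV zV [[nxy ix iy] [nxz _ iz] [nyz _ _]].
have br u : u \in V -> infinite_at H w u -> exists v,
    [/\ v \in V, conn w u v & infinite_at H (set_edges false B w) v].
  move=> uV iu.
  have [v [vV uv iv]] := infinite_branch endB (@off_set_edges _ _ B w) iu.
  by exists v; split => //; case: vV => [->|].
have ncut u v u' v' : conn w u u' -> conn w v v' -> ~ conn w u v ->
    ~ conn (set_edges false B w) u' v'.
  move=> uu' vv' nuv h; apply: nuv; apply: conn_trans uu' _.
  apply: conn_trans (conn_sym vv').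
  by apply: sub_conn h => e; exact: set_edges_closed_sub.
have [x' [xV' xx' ix']] := br x xV ix.
have [y' [yV' yy' iy']] := br y yV iy.
have [z' [zV' zz' iz']] := br z zV iz.
exists x', y', z'; split => //; split; split => //.
- exact: ncut xx' yy' nxy.
- exact: ncut xx' zz' nxz.
- exact: ncut yy' zz' nyz.
Qed.

Section Law.
Variables (R : realType) (p : R) (P : probability (config S) R).
Hypothesis p01 : 0 <= p <= 1.
Hypothesis hP : bernoulli_percolation p P.

Lemma negligible_exists (Q : Gam -> set (config S)) :
  (forall x, P.-negligible (Q x)) -> P.-negligible [set w | exists x, Q x w].
Proof.
move=> nQ; have [g gP] := group_enum genS.
apply: (@negligibleS _ _ _ _ (\bigcup_n Q (g n))).
  by move=> w /= [x Qx]; have [n gn] := gP x; exists n => //; rewrite gn.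
exact: negligible_bigcup.
Qed.

(** On the event that [B] is open, opening [B] changes nothing.  By independence
    and invariant_open_ge, the event that non-uniqueness holds after opening [B]
    is thus at least as likely as non-uniqueness itself, in which it is contained. *)
Lemma open_stays_nonunique B (V : {fset Gam}) : 0 < p -> infinite_set H ->
  pattern B V ->
  P.-negligible (nonunique `\` set_edges true B @^-1` nonunique).
Proof.
move=> p0 infH pB.
have mN := measurable_nonunique.
have mN' : measurable (set_edges true B @^-1` nonunique).
  by apply: measurable_preimage => //; exact: measurable_set_edges.
have sub : set_edges true B @^-1` nonunique `<=` nonunique.
  by move=> w; exact: nonunique_set_open pB.
have q0 : 0 < p ^+ #|` B| by rewrite exprn_gt0.
have le1 := invariant_open_ge p01 hP infH pB mN nonunique_invariant.
have OE : open_event B `&` nonunique = open_event B `&` set_edges true B @^-1` nonunique.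
  have oE w : open_event B w -> set_edges true B w = w.
    by move=> ow; apply/funext => e; rewrite /set_edges; case: ifP => // /ow ->.
  by apply/seteqP; split=> w /= [ow]; rewrite oE.
rewrite OE (prob_open_set_edges hP) ?ler_pM2l // in le1.
apply/negligibleP; first exact: measurableD.
rewrite measureD //; last by rewrite ltey_eq fin_num_measure.
rewrite (setIidr sub).
have eqP : fine (P nonunique) = fine (P (set_edges true B @^-1` nonunique)).
  apply/eqP; rewrite eq_le le1 /=; apply: fine_le; rewrite ?fin_num_measure //.
  by apply: le_measure; rewrite ?inE.
have PE : P nonunique = P (set_edges true B @^-1` nonunique).
  by rewrite -[LHS]fineK ?fin_num_measure // eqP fineK ?fin_num_measure.
by rewrite [X in (X - _)%E]PE subee // fin_num_measure.
Qed.

(** Apply open_stays_nonunique to one pattern through each of the countably many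
    pairs of vertices. *)
Lemma nonunique_has_third : 0 < p -> infinite_set H ->
  P.-negligible (nonunique `\` [set w | exists x y z, three_clusters w x y z]).
Proof.
move=> p0 infH.
have [f fP] : exists f : Gam * Gam -> {fset E} * {fset Gam}, forall xy,
    [/\ pattern (f xy).1 (f xy).2, xy.1 \in (f xy).2 & xy.2 \in (f xy).2].
  suff h xy : exists BV : {fset E} * {fset Gam},
      [/\ pattern BV.1 BV.2, xy.1 \in BV.2 & xy.2 \in BV.2].
    by have [f fP] := choice h; exists f.
  case: xy => x y; have [B [V [pB sV]]] := pattern_exists genS [:: x; y].
  by exists (B, V); split => //; apply: sV; rewrite !inE eqxx ?orbT.
apply: (@negligibleS _ _ _ _ [set w | exists x y,
    (nonunique `\` set_edges true (f (x, y)).1 @^-1` nonunique) w]).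
  move=> w /= [nw no3]; have [x [y xy]] := nw; exists x, y; split => // nw'.
  have [pB xV yV] := fP (x, y).
  have [z xyz] := third_cluster pB xV yV xy nw'.
  by apply: no3; exists x, y, z.
apply: negligible_exists => x; apply: negligible_exists => y.
by have [pB _ _] := fP (x, y); exact: open_stays_nonunique pB.
Qed.

End Law.
End Clusters.

(** * Foelner sets *)

(** [K0] is the set of the [x] in [K] with [x * F] inside [K].  Each [s] in [F]
    excludes as many points as [K * s] has outside [K], which is at most
    [#|K| / (2 (#|F| + 1))] for the Foelner set chosen. *)
Lemma folner_interior (Gam : groupType) (H : set Gam) (F : {fset Gam}) :
  amenable H -> [set` F] `<=` H ->
  exists K K0 : {fset Gam}, [/\ (0 < #|` K0|)%N, (#|` K| <= 2 * #|` K0|)%N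
    & forall x s, x \in K0 -> s \in F -> (x * s)%g \in K].
Proof.
move=> amH FH.
pose m : rat := (2 * #|` F|.+1)%:R.
have m0 : 0 < m by rewrite ltr0n muln_gt0.
have [|K [Kn0 _ KF]] := amH F m^-1 FH; first by rewrite invr_gt0.
pose bad s := [fset x in K | (x * s)%g \notin K]%fset.
have inbad s x : (x \in bad s) = (x \in K) && ((x * s)%g \notin K) by rewrite !inE.
pose K0 := [fset x in K | all (fun s => (x * s)%g \in K) F]%fset.
have inK0 x : (x \in K0) = (x \in K) && all (fun s => (x * s)%g \in K) F by rewrite !inE.
have K0K : (K0 `<=` K)%fset by apply/fsubsetP => x; rewrite inK0 => /andP[].
have badE s : s \in F -> #|` bad s|%:R <= m^-1 * #|` K|%:R.
  move=> /KF; apply: le_trans; rewrite ler_nat.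
  have <- : #|` [fset (x * s)%g | x in bad s]%fset| = #|` bad s|.
    by rewrite card_imfset //; exact: mulIg.
  apply/fsubset_leq_card/fsubsetP => y /imfsetP[x /=]; rewrite inbad => /andP[xK xs] ->.
  by rewrite in_fsetD xs; apply/imfsetP; exists x.
have cover : (#|` K `\` K0| <= \sum_(s <- F) #|` bad s|)%N%fset.
  have -> : (K `\` K0 = \bigcup_(s <- F) bad s)%fset.
    apply/fsetP => x; rewrite in_fsetD inK0; apply/idP/bigfcupP.
      move=> /andP[+ xK]; rewrite xK /= => /allPn[s sF xs].
      by exists s; rewrite ?sF // inbad xK.
    by move=> [s /andP[sF _]]; rewrite inbad => /andP[-> xs]; rewrite andbT; apply/allPn; exists s.
  elim/big_rec2: _ => [|s n A _ h]; first by rewrite cardfs0.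
  apply: leq_trans (leq_card_fsetU _ _).1 _.
  by rewrite leq_add2l.
have Kpos : (0 < #|` K|)%N by rewrite cardfs_gt0.
have half : (2 * #|` K `\` K0| <= #|` K|)%N%fset.
  rewrite -(ler_nat rat) natrM.
  have k0 : 0 <= #|` K|%:R :> rat by [].
  have : (#|` K `\` K0|%fset)%:R <= #|` F|%:R * (m^-1 * #|` K|%:R).
    apply: (@le_trans _ _ (\sum_(s <- F) #|` bad s|%:R)).
      by rewrite -natr_sum ler_nat.
    apply: (@le_trans _ _ (\sum_(s <- F) (m^-1 * #|` K|%:R))).
      by rewrite big_seq [leRHS]big_seq; apply: ler_sum => s; exact: badE.
    by rewrite big_const_seq count_predT iter_addr_0 -[_ *+ size _]mulr_natl.
  rewrite mulrA => le1.
  have le2 : #|` F|%:R * m^-1 <= 2^-1 :> rat.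
    by rewrite ler_pdivrMr // /m natrM mulKf // ler_nat.
  have := le_trans le1 (ler_wpM2r k0 le2); lra.
have KE : #|` K| = (#|` K0| + #|` K `\` K0|%fset)%N.
  by rewrite -(cardfsID K0 K) (fsetIidPr K0K).
exists K, K0; split => //.
- by move: half Kpos; rewrite KE; case: #|` K0| => //; lia.
- by move: half; rewrite KE; lia.
- by move=> x s; rewrite inK0 => /andP[_ /allP h] /h.
Qed.

(** * Trifurcations are rare *)

Section Trifurcation.
Variables (Gam : groupType) (S : {fset Gam}).
Local Notation E := (cayley_edges S).
Hypothesis genS : generated [set` S] = [set: Gam].
Variable H : set Gam.
Implicit Types (w : config S) (x y z h : Gam) (B : {fset E}).

(** The cardinality of the trace on [F] of the cluster of [x] is bounded below by
    means of a witness, so that the event is a finite union of finite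
    intersections of connection events. *)
Definition reaches (F : {fset Gam}) (m : nat) w x : Prop :=
  exists s : {fset Gam}, [/\ (s `<=` F)%fset, (m <= #|` s|)%N
    & forall f, f \in s -> conn w x f].

Lemma measurable_reaches F m x : measurable [set w : config S | reaches F m w x].
Proof.
pose D := [set s : {fset Gam} | (s `<=` F)%fset /\ (m <= #|` s|)%N].
rewrite (_ : mkset _ = \bigcup_(s in D) \bigcap_(f in [set` s])
    [set w : config S | conn w x f]); last first.
  apply/seteqP; split=> w /=.
    by move=> [s [sF ms h]]; exists s.
  by move=> [s [sF ms] h]; exists s.
apply: fin_bigcup_measurable => [|s _].
  apply: (@sub_finite_set _ _ [set` fpowerset F]); last exact: finite_fset.
  by move=> s [sF _] /=; rewrite fpowersetE.
by apply: fin_bigcap_measurable => // f _; exact: measurable_conn.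
Qed.

Lemma infinite_reaches (g : nat -> Gam) w x m :
  (forall y, exists n, g n = y) -> infinite_at H w x ->
  exists n, reaches [fset y in map g (iota 0 n) | `[< H y >]]%fset m w x.
Proof.
move=> gP inf; have [s sx ms] := infinite_set_fset m inf.
have [n nP] := enum_bound s gP.
exists n, s; split => // [|f /sx[]//].
apply/fsubsetP => y ys; rewrite !inE /=; have [_ Hy] := sx y ys.
have [k kn gk] := nP y ys; apply/andP; split; last exact/asboolP.
by rewrite -gk map_f // mem_iota.
Qed.

Lemma reachesS F F' m w x : (F `<=` F')%fset -> reaches F m w x -> reaches F' m w x.
Proof.
by move=> FF' [s [sF ms h]]; exists s; split => //; exact: fsubset_trans FF'.
Qed.

(** The bound [m] and the finite set [F] truncate the condition that the three
    branches be [H]-infinite, so that it can be verified inside a Foelner set. *)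
Definition trifurcation B v1 v2 v3 F m : set (config S) :=
  [set w | edges_open B w /\ let w' := set_edges false B w in
     [/\ ~ conn w' v1 v2, ~ conn w' v1 v3, ~ conn w' v2 v3 &
      [/\ reaches F m w' v1, reaches F m w' v2 & reaches F m w' v3]]].

Lemma measurable_trifurcation B v1 v2 v3 F m :
  measurable (trifurcation B v1 v2 v3 F m).
Proof.
have mpre A : measurable A -> measurable (set_edges false B @^-1` A : set (config S)).
  by move=> mA; apply: measurable_preimage => //; exact: measurable_set_edges.
pose N x y : set (config S) := ~` [set w | conn w x y].
pose Q x : set (config S) := [set w | reaches F m w x].
have mN x y : measurable (N x y) by apply: measurableC; exact: measurable_conn.
have mQ x : measurable (Q x) by exact: measurable_reaches.
rewrite (_ : trifurcation _ _ _ _ _ _ = open_event B `&` set_edges false B @^-1`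
   (N v1 v2 `&` N v1 v3 `&` N v2 v3 `&` (Q v1 `&` Q v2 `&` Q v3))); last first.
  apply/seteqP; split=> w /=.
    by move=> [oB [? ? ? [? ? ?]]]; do !split.
  by move=> [oB [[[? ?] ?] [[? ?] ?]]]; do !split.
apply: measurableI; first exact: measurable_edges_open.
by apply: mpre; do ! [exact: mN | exact: mQ | apply: measurableI].
Qed.

Section Law.
Variables (R : realType) (p : R) (P : probability (config S) R).
Hypothesis hP : bernoulli_percolation p P.

(** Sum over the interior [K0] of a Foelner set [K] for [F].  By
    branch_points_card at most [#|pattern_overlap V| * #|K| / m] of the translated
    trifurcation events occur in any configuration, each has the same
    probability, and [#|K| <= 2 * #|K0|]. *)
Lemma prob_trifurcation_le B (V : {fset Gam}) v1 v2 v3 F m : amenable H ->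
  pattern B V -> v1 \in V -> v2 \in V -> v3 \in V -> (0 < m)%N ->
  [set` F] `<=` H ->
  m%:R * fine (P (trifurcation B v1 v2 v3 F m)) <= (2 * #|` pattern_overlap V|)%:R.
Proof.
move=> amH pB V1 V2 V3 m0 FH.
set T := trifurcation B v1 v2 v3 F m; set d := #|` pattern_overlap V|.
have mT : measurable T by exact: measurable_trifurcation.
have [K [K0 [K00 KK0 K0F]]] := folner_interior amH FH.
pose Tx x := translate x @^-1` T.
have mTx x : measurable (Tx x).
  by apply: measurable_preimage => //; exact: measurable_translate.
have PTx x : fine (P (Tx x)) = fine (P T) by exact: (prob_translate hP).
have count w : \sum_(x <- K0) \1_(Tx x) w * m%:R <= (d * #|` K|)%:R :> R.
  pose Tw := [fset x in K0 | `[< Tx x w >]]%fset.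
  have -> : \sum_(x <- K0) \1_(Tx x) w * m%:R = (m * #|` Tw|)%:R :> R.
    rewrite -mulr_suml natrM mulrC; congr (_ * _).
    rewrite card_fset_sum1 -big_fset_condE natr_sum [RHS]big_mkcond /=.
    apply: eq_bigr => x _; rewrite indicE; case: ifP => [/asboolP h|/asboolP h].
      by rewrite mem_set.
    by rewrite memNset.
  rewrite ler_nat; apply: (branch_points_card (w := w) pB V1 V2 V3 m0) => x.
  rewrite !inE => /andP[xK0 /asboolP[oB [n12 n13 n23 [r1 r2 r3]]]] w' big.
  have many v : reaches F m w' v -> big v.
    move=> [s [sF ms sv]]; apply: (leq_trans ms).
    have <- : #|` [fset (x * f)%g | f in s]%fset| = #|` s|.
      by rewrite card_imfset //; exact: mulgI.
    apply/fsubset_leq_card/fsubsetP => _ /imfsetP[f /= fs ->].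
    rewrite !inE /= (K0F x f xK0) ?(fsubsetP sF) //=.
    by apply/asboolP; rewrite mulKg; exact: sv.
  by split => //; split; exact: many.
pose f w := (d * #|` K|)%:R + (-1) * \sum_(x <- K0) m%:R * \1_(Tx x) w : R.
have hf : has_mean P f ((d * #|` K|)%:R + (-1) * \sum_(x <- K0) m%:R * fine (P T)).
  apply: has_meanD; first exact: has_mean_cst.
  apply: has_meanZ; apply: has_mean_sum => x _; apply: has_meanZ.
  by rewrite -(PTx x); exact: has_mean_indic.
have f0 w : 0 <= f w.
  rewrite /f mulN1r subr_ge0; apply: le_trans (count w).
  by rewrite le_eqVlt; apply/orP; left; apply/eqP; apply: eq_bigr => x _; rewrite mulrC.
have := has_mean_ge0 hf f0.
rewrite mulN1r subr_ge0 big_const_seq count_predT iter_addr_0 -[(_ * _) *+ _]mulr_natr.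
move: (m%:R * _) => u uK.
have : u * (#|` K0|)%:R <= (2 * d)%:R * (#|` K0|)%:R.
  apply: (le_trans uK); rewrite -natrM ler_nat -mulnA mulnCA leq_mul2l.
  by rewrite KK0 orbT.
by rewrite ler_pM2r // ltr0n.
Qed.

End Law.
End Trifurcation.

(** * Uniqueness *)

Section Uniqueness.
Variables (Gam : groupType) (S : {fset Gam}).
Local Notation E := (cayley_edges S).
Hypothesis genS : generated [set` S] = [set: Gam].
Variable H : set Gam.
Hypothesis sgH : subgroup H.
Variables (R : realType) (p : R) (P : probability (config S) R).
Hypothesis p01 : 0 <= p <= 1.
Hypothesis hP : bernoulli_percolation p P.
Implicit Types (w : config S) (x y z h : Gam) (B : {fset E}).

(** Almost surely no edge is open, so that all clusters are singletons. *)
Lemma nonunique_negligible_p0 : p = 0 -> P.-negligible (nonunique H : set (config S)).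
Proof.
move=> p0; apply: (@negligibleS _ _ _ _ [set w | exists x y, open_adj w x y]).
  move=> w [x [_ [_ ix _]]]; apply: contrapT => no; apply: ix.
  apply: (@sub_finite_set _ _ [set x]); last exact: finite_set1.
  move=> y [xy _]; apply: (conn_preserves (Q := fun z => z = x) _ xy) => // a b _ ab.
  by case: no; exists a, b.
apply: (negligible_exists genS) => x; apply: (negligible_exists genS) => y.
have [[e eE]|ne] := pselect (exists e : E, set_val e = [set x; y]); last first.
  apply: (@negligibleS _ _ _ _ set0); last exact: negligible_set0.
  by move=> w [e [eE _]]; apply: ne; exists e.
apply: (@negligibleS _ _ _ _ (open_event [fset e]%fset)).
  move=> w [f [fE wf]] e' /fset1P ->.
  by rewrite (_ : e = f) //; apply: edge_inj; rewrite eE.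
apply/negligibleP; first exact: measurable_edges_open.
have := prob_open hP [fset e]%fset; rewrite p0 cardfs1 expr1 => h.
by rewrite -[LHS]fineK ?h // fin_num_measure //; exact: measurable_edges_open.
Qed.

(** Fix vertices [x], [y], [z] that are with positive probability in three distinct
    [H]-infinite clusters, and a pattern [B] through them.  When [B] is closed
    each of the clusters keeps an [H]-infinite piece attached to [B]; which vertices
    of [B] carry these pieces can be fixed too.  This condition does not look at
    the edges of [B], so it is compatible with [B] being open. *)
Lemma nonnegligible_trifurcation : 0 < p ->
  ~ P.-negligible (nonunique H : set (config S)) ->
  exists B (V : {fset Gam}) v1 v2 v3, [/\ pattern B V, v1 \in V, v2 \in V, v3 \in V
    & 0 < fine (P (open_event B `&` set_edges false B @^-1`
        [set w | three_clusters H w v1 v2 v3]))].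
Proof.
move=> p0 nn.
have nn_exists (Q : Gam -> set (config S)) :
    ~ P.-negligible [set w | exists x, Q x w] -> exists x, ~ P.-negligible (Q x).
  move=> nQ; apply: contrapT => no; apply: nQ; apply: (negligible_exists genS) => x.
  by apply: contrapT => nx; apply: no; exists x.
have infH : infinite_set H.
  move=> finH; apply: nn; apply: (@negligibleS _ _ _ _ set0); last exact: negligible_set0.
  by move=> w [x [_ [_ ix _]]]; apply: ix; apply: sub_finite_set finH => y [].
have : ~ P.-negligible [set w | exists x y z, three_clusters H w x y z].
  move=> n3; apply: nn.
  apply: negligibleS (negligibleU (nonunique_has_third genS sgH p01 hP p0 infH) n3).
  move=> w nw; have [h3|n3w] := pselect (exists x y z, three_clusters H w x y z).
    by right.
  by left.
move=> /nn_exists[x /nn_exists[y /nn_exists[z nxyz]]].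
have [B [V [pB sV]]] := pattern_exists genS [:: x; y; z].
have : ~ P.-negligible [set w | exists x' y' z', [/\ x' \in V, y' \in V, z' \in V &
    three_clusters H (set_edges false B w) x' y' z']].
  move=> n3; apply: nxyz; apply: negligibleS n3 => w /= h3.
  by apply: (three_branches pB) h3; apply: sV; rewrite !inE eqxx ?orbT.
move=> /nn_exists[v1 /nn_exists[v2 /nn_exists[v3 nv]]].
have [V1 V2 V3] : [/\ v1 \in V, v2 \in V & v3 \in V].
  apply: contrapT => no; apply: nv.
  apply: (@negligibleS _ _ _ _ set0); last exact: negligible_set0.
  by move=> w /= [V1 V2 V3 _]; apply: no.
exists B, V, v1, v2, v3; split => //.
have m3 : measurable [set w : config S | three_clusters H w v1 v2 v3].
  exact: measurable_three_clusters.
have m3' := measurable_preimage (measurable_set_edges false B) m3.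
rewrite (prob_open_set_edges hP) // mulr_gt0 ?exprn_gt0 //.
rewrite lt_neqAle fine_ge0 // andbT; apply/eqP => P0; apply: nv.
apply: (@negligibleS _ _ _ _ (set_edges false B @^-1`
  [set w | three_clusters H w v1 v2 v3])); first by move=> w /= [].
apply/negligibleP => //.
by rewrite -[LHS]fineK ?fin_num_measure // -P0.
Qed.

(** With [c] the probability of a trifurcation with infinite branches and [d] the
    constant of prob_trifurcation_le, take [m > 4 d / c].  The truncated
    events increase to the full one as [F] exhausts [H], so for some [F] they have
    probability above [c / 2], and [m * (c / 2) > 2 * d]. *)
Lemma nonunique_negligible : amenable H -> P.-negligible (nonunique H : set (config S)).
Proof.
move=> amH; have [p0|pn0] := eqVneq p 0; first exact: nonunique_negligible_p0.
have {pn0}p0 : 0 < p by rewrite lt_neqAle eq_sym pn0; case/andP: p01.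
apply: contrapT => /(nonnegligible_trifurcation p0).
move=> [B [V [v1 [v2 [v3 [pB V1 V2 V3]]]]]].
set T := _ `&` _; set c := fine (P T) => c0.
pose d := #|` pattern_overlap V|.
have [m md] : exists m : nat, 4 * d%:R / c < m%:R.
  exists (Num.bound (4 * d%:R / c)); apply: archi_boundP.
  by rewrite divr_ge0 ?mulr_ge0 // ltW.
have m0 : (0 < m)%N.
  by rewrite -(ltr0n R); apply: le_lt_trans md; rewrite divr_ge0 ?mulr_ge0 // ltW.
have [g gP] := group_enum genS.
pose F n := [fset y in map g (iota 0 n) | `[< H y >]]%fset.
have FS n k : (n <= k)%N -> (F n `<=` F k)%fset.
  move=> nk; apply/fsubsetP => y; rewrite !inE /= => /andP[/mapP[i ni ->] ->].
  rewrite andbT map_f //; move: ni; rewrite !mem_iota !add0n /= => ni.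
  exact: leq_trans nk.
pose Tn n := trifurcation B v1 v2 v3 (F n) m : set (config S).
have mTn n : measurable (Tn n) by exact: measurable_trifurcation.
have ndT : {homo Tn : n k / (n <= k)%N >-> (n <= k)%O}.
  move=> n k /FS nk; apply/subsetPset => w [oB [? ? ? [r1 r2 r3]]].
  by split => //; split => //; split; exact: reachesS nk _.
have TU : T `<=` \bigcup_n Tn n.
  move=> w [oB [[n12 i1 i2] [n13 _ i3] [n23 _ _]]].
  have [k1 r1] := infinite_reaches m gP i1.
  have [k2 r2] := infinite_reaches m gP i2.
  have [k3 r3] := infinite_reaches m gP i3.
  exists (maxn k1 (maxn k2 k3)) => //; split => //; split => //; split.
  - by apply: reachesS r1; apply: FS; rewrite leq_maxl.
  - by apply: reachesS r2; apply: FS; rewrite !leq_max leqnn orbT.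
  - by apply: reachesS r3; apply: FS; rewrite !leq_max leqnn !orbT.
have mT : measurable T.
  apply: measurableI; first exact: measurable_edges_open.
  apply: measurable_preimage; first exact: measurable_set_edges.
  exact: measurable_three_clusters.
have mU : measurable (\bigcup_n Tn n) by exact: bigcupT_measurable.
have cU : c <= fine (P (\bigcup_n Tn n)).
  apply: fine_le; rewrite ?fin_num_measure //.
  by apply: le_measure; rewrite ?inE.
have cvgT := @prob_bigcup_cvg _ _ _ P Tn mTn ndT.
have c2 : c / 2 < fine (P (\bigcup_n Tn n)).
  by apply: lt_le_trans cU; rewrite ltr_pdivrMr // ltr_pMr // ltr1n.
have [n _ /(_ n (leqnn n)) cn] := cvgr_gt _ cvgT _ c2.
have FH : [set` F n] `<=` H by move=> y; rewrite /= !inE /= => /andP[_ /asboolP].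
have := prob_trifurcation_le genS hP amH pB V1 V2 V3 m0 FH.
apply/negP; rewrite -ltNge -/d.
apply: (@lt_trans _ _ (m%:R * (c / 2))); last by rewrite ltr_pM2l ?ltr0n.
rewrite natrM mulrA ltr_pdivlMr // -ltr_pdivrMr // (_ : 2 * d%:R * 2 = 4 * d%:R) //.
by ring.
Qed.

End Uniqueness.

Theorem theorem1p7 (R : realType) (Gam : groupType) (S : {fset Gam})
    (genS : generated [set` S] = [set: Gam])
    (Perc : R -> probability (config S) R)
    (hPerc : forall p : R, 0 <= p <= 1 -> bernoulli_percolation p (Perc p))
    (H : set Gam) (sgH : subgroup H) (amH : amenable H) :
  (forall p : R, 0 <= p <= 1 ->
    {ae Perc p, forall w, forall K1 K2 : set Gam,
      infinite_cluster H w K1 -> infinite_cluster H w K2 -> K1 = K2}) /\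
  p_c Perc H = p_u Perc H.
Proof.
have uniq (p : R) : 0 <= p <= 1 ->
    {ae Perc p, forall w, forall K1 K2 : set Gam,
      infinite_cluster H w K1 -> infinite_cluster H w K2 -> K1 = K2}.
  move=> p01; apply: negligibleS (nonunique_negligible genS sgH p01 (hPerc p p01) amH).
  move=> w /= /existsNP[K1 /existsNP[K2 /not_implyP[[[x _ <-] ix]]]].
  move=> /not_implyP[[[y _ <-] iy] nxy]; exists x, y; split => //.
  by move=> xy; apply: nxy; exact: cluster_eq.
(* By uniqueness the infima are taken over the same set of parameters. *)
split => //; rewrite /p_c /p_u; congr ereal_inf.
apply/seteqP; split=> _ [p [p01 ex] <-]; exists p => //; split => //.
  apply: filterS2 ex (uniq p p01) => w [K iK] unq; exists K; split => // K' iK'.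
  exact: unq.
by apply: filterS ex => w [K [iK _]]; exists K.
Qed.
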